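(* Let $q=2^n$, where $n\ge 2$ is a natural number. Then $$\kappa(L_2(q))=q^{(q-2)(q+1)}\,(q-1)^{(q-3)q(q+1)/2}\,(q+1)^{(q-1)^2q/2}.$$ In particular, when $q=4$, we have $L_2(4)\cong L_2(5)\cong\mathbb{A}_5$, and so $\kappa(L_2(5))=\kappa(\mathbb{A}_5)=2^{20}\cdot 3^{10}\cdot 5^{18}$.
   Context: $L_2(q)=\mathrm{PSL}(2,q)$ is the projective special linear group over the field with $q$ elements, and $\mathbb{A}_5$ is the alternating group on $5$ letters. For a finite group $G$, the commuting graph $\mathcal{C}(G)$ is the simple graph with vertex set $G$ in which two distinct elements are adjacent if and only if they commute. $\kappa(G)$ denotes the number of spanning trees of $\mathcal{C}(G)$. *)

(* Defs.v *)
From HB Require Import structures.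
From mathcomp Require Import all_boot all_order all_algebra all_fingroup all_solvable.

Set Implicit Arguments.
Unset Strict Implicit.
Unset Printing Implicit Defensive.

Import GroupScope.

Record sgraph := SGraph {
  vertex :> finType;
  adj : rel vertex;
  adj_sym : symmetric adj;
  adj_irr : irreflexive adj }.

Definition edges (X : sgraph) : {set {set X}} :=
  [set [set x; y] | x in X, y in X & adj x y].

Section EdgeSets.
Variables (V : finType) (E : {set {set V}}).

Definition edge_rel : rel V := [rel x y | [set x; y] \in E].

Definition edges_connected : bool := [forall x, forall y, connect edge_rel x y].

(* A cycle is a closed walk through at least 3 pairwise distinct vertices;   *)
(* its length is thus at most #|V|, which makes the quantification finite.   *)
Definition edges_acyclic : bool :=
  [forall k : 'I_#|V|.+1, (2 < k)%N ==>
     [forall c : k.-tuple V, ~~ ucycleb edge_rel c]].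

Lemma edges_acyclicP :
  reflect (forall c : seq V, ucycle edge_rel c -> (size c <= 2)%N)
          edges_acyclic.
Proof.
apply: (iffP forallP) => [acE c /andP[cyc_c Uc] | acE k].
  rewrite leqNgt; apply/negP => c_gt2.
  have c_le : (size c < #|V|.+1)%N by rewrite ltnS -(card_uniqP Uc) max_card.
  have /implyP/(_ c_gt2)/forallP/(_ (in_tuple c)) := acE (Ordinal c_le).
  by rewrite /ucycleb /= cyc_c Uc.
apply/implyP => k_gt2; apply/forallP => c; apply/negP => /acE.
by rewrite size_tuple leqNgt k_gt2.
Qed.

End EdgeSets.

(* A spanning tree is identified with its edge set.                          *)
Definition spanning_tree (X : sgraph) (E : {set {set X}}) : bool :=
  [&& E \subset edges X, edges_connected E & edges_acyclic E].

Definition num_spanning_trees (X : sgraph) : nat :=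
  #|[set E : {set {set X}} | spanning_tree E]|.

Section CommutingGraph.
Variables (gT : finGroupType) (G : {group gT}).

Definition comm_adj : rel [subg G] := [rel x y | (x != y) && (x * y == y * x)].

Fact comm_adj_sym : symmetric comm_adj.
Proof. by move=> x y; rewrite /comm_adj /= eq_sym [x * y == _]eq_sym. Qed.

Fact comm_adj_irr : irreflexive comm_adj.
Proof. by move=> x; rewrite /comm_adj /= eqxx. Qed.

Definition commuting_graph : sgraph := SGraph comm_adj_sym comm_adj_irr.

Definition kappa : nat := num_spanning_trees commuting_graph.

End CommutingGraph.

Section SpecialLinear.
(* As for {'GL_n[F]}, the dimension is n.-1.+1, i.e., n when n > 0.           *)
Variables (n : nat) (F : finFieldType).

Definition SL : {set {'GL_n[F]}} := [set u | (\det (GLval u) == 1)%R].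

Fact SL_group_set : group_set SL.
Proof.
apply/group_setP; split=> [|u v]; rewrite !inE; first by rewrite GL_1E det1.
by move=> /eqP du /eqP dv; rewrite GL_MxE det_mulmx du dv GRing.mulr1.
Qed.
Canonical SL_group := Group SL_group_set.

Definition PSL : {set coset_of 'Z(SL)} := SL / 'Z(SL).
Canonical PSL_group := [group of PSL].

End SpecialLinear.

Notation "''L_2' ( F )" := (PSL 2 F) (format "''L_2' ( F )") : group_scope.
Notation "''L_2' ( F )" := (PSL_group 2 F) : Group_scope.

(* Main.v *)
(* Rooting the spanning trees of a connected graph at a vertex e turns them   *)
(* into parent functions without cycles. In the commuting graph take e = 1:   *)
(* when the centralizers of the nontrivial elements are abelian, they meet    *)
(* pairwise in 1 and the parent function splits into one forest function for  *)
(* each centralizer C, attached to the root 1. By Cayley's formula there are  *)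
(* |C|^(|C| - 2) of these, so kappa is the product of these powers.           *)
(*   In SL(2,q), q even, the centralizer of x <> 1 is the set of the s + r x  *)
(* of determinant s^2 + t r s + r^2 = 1, t the trace of x. It has order       *)
(* q + 1 - rho where rho is the number of roots of X^2 + t X + 1, because     *)
(* every point of the projective line off the roots has a unique norm 1       *)
(* representative. There are q (q - 1 + rho) elements of trace t, and         *)
(* rho = 1, 2, 0 for 1, (q - 2)/2 and q/2 traces t respectively.              *)
(*   L_2(4) and L_2(5) are identified with A_5 through actions on 5 points,   *)
(* A_5 being the only subgroup of order 60 of S_5.                            *)

Require Import Defs.
From HB Require Import structures.
From mathcomp Require Import all_boot all_order all_algebra all_fingroup all_solvable.
From mathcomp Require Import all_field.
From mathcomp Require Import ring zify.

Set Implicit Arguments.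
Unset Strict Implicit.
Unset Printing Implicit Defensive.

(** * Spanning trees as parent functions *)

(** For even q the only scalar in SL(2,q) is 1, so [SL2_isog_PSL2] and [kappa_isog] move the count
    to SL(2,q). Rooted at 1, a spanning tree is the function sending every other element to its
    neighbour towards 1 ([num_spanning_treesE]). Abelian centralizers of nontrivial elements
    partition these elements, and parents stay inside a centralizer, so a centralizer of order c
    contributes c^(c - 2) by [card_forests] with one root; [kappa_centralizers] collects equal
    orders. Counting elements by trace ([card_cent_class]) yields q + 1 centralizers of order q
    (Sylow 2-subgroups), q(q + 1)/2 of order q - 1 (split tori) and q(q - 1)/2 of order q + 1
    (nonsplit tori); [kappa_SL2] multiplies these contributions. The projective line for q = 4 and
    an exceptional action for q = 5 each have five points, which gives an image of order 60 in S_5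
    ([quotient_isog_Alt5]). *)

Section Acyclic.
Variable T : finType.
Implicit Types (A S : {set T}) (f : {ffun T -> T}).

(* Equivalently, the f-orbit of every point leaves A. *)
Definition acyclic_on A f : bool :=
  [forall S : {set T}, (S \subset A) && [forall x in S, f x \in S] ==> (S == set0)].

Lemma acyclic_onP A f :
  reflect (forall S, S \subset A -> (forall x, x \in S -> f x \in S) -> S = set0)
          (acyclic_on A f).
Proof.
apply: (iffP forallP) => [H S sSA fS | H S].
  have /implyP/(_ _)/eqP := H S; apply; rewrite sSA.
  by apply/forallP => x; apply/implyP/fS.
by apply/implyP => /andP[sSA /forall_inP fS]; apply/eqP/H.
Qed.

Lemma acyclic_on_rank A f (d : T -> nat) :
  {in A, forall x, d (f x) < d x} -> acyclic_on A f.
Proof.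
move=> df; apply/acyclic_onP => S /subsetP sSA fS; apply/eqP/set0Pn => -[x Sx].
have [y Sy miny] := arg_minnP d Sx.
by have := miny _ (fS _ Sy); rewrite leqNgt df ?sSA.
Qed.

(** The points whose orbit misses [e] form a stable set avoiding [e], so there are none; the rank is
    the number of steps needed to reach [e]. *)
Lemma rank_acyclic_on e f : acyclic_on [set~ e] f ->
  exists2 d : T -> nat, d e = 0 & forall x, x != e -> d (f x) < d x.
Proof.
move=> /acyclic_onP acf.
have reach x : fconnect f x e.
  have: x \notin [set y | ~~ fconnect f y e].
    rewrite (acf [set y | ~~ fconnect f y e]) ?inE // => [|y].
      by apply/subsetP => y; rewrite !inE; apply: contra => /eqP->.
    by rewrite !inE; apply: contra; apply/connect_trans/fconnect1.
  by rewrite inE negbK.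
have itx x : exists k, iter k f x == e.
  by exists (findex f x e); rewrite iter_findex.
exists (fun x => ex_minn (itx x)) => [|x nx].
  by case: ex_minnP => m _ /(_ 0 (eqxx _)); rewrite leqn0 => /eqP.
case: (ex_minnP (itx x)) => -[|m]; first by rewrite /= (negPf nx).
rewrite iterSr => mP _; case: ex_minnP => k _; exact.
Qed.

End Acyclic.

Section SpanningTrees.
Variables (X : sgraph) (e : X).
Implicit Types (f : {ffun X -> X}) (E : {set {set X}}).

Definition parent_funs : {set {ffun X -> X}} :=
  [set f : {ffun X -> X} | [&& f e == e, [forall x, (x != e) ==> adj x (f x)]
             & acyclic_on [set~ e] f]].

Lemma parent_funsP f :
  reflect [/\ f e = e, forall x, x != e -> adj x (f x) & acyclic_on [set~ e] f]
          (f \in parent_funs).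
Proof.
rewrite inE; apply: (iffP and3P) => -[fe fa acf]; split => //.
- exact/eqP.
- by move=> x nx; have /implyP := forallP fa x; apply.
- exact/eqP.
- by apply/forallP => x; apply/implyP/fa.
Qed.

Definition parent_edges f : {set {set X}} := [set [set x; f x] | x in [set~ e]].

Lemma set2_eqP (x y a b : X) :
  reflect (x = a /\ y = b \/ x = b /\ y = a) ([set x; y] == [set a; b]).
Proof.
apply: (iffP eqP) => [eq2|]; last by case=> -[-> ->]; rewrite // setUC.
have [xab yab axy bxy] : [/\ x \in [set a; b], y \in [set a; b],
    a \in [set x; y] & b \in [set x; y]].
  by rewrite eq2 set21 set22 -eq2 set21 set22.
move: xab yab axy bxy; rewrite !inE.
by do 4!case/orP=> /eqP ?; subst; auto.
Qed.

Lemma parent_edgesP f x y :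
  reflect (x != e /\ y = f x \/ y != e /\ x = f y)
          ([set x; y] \in parent_edges f).
Proof.
apply: (iffP imsetP) => [[z] | [] [nz ->]]; last by exists y; rewrite ?inE // setUC.
  by rewrite !inE => nz /eqP/set2_eqP[[-> ->]|[-> ->]]; auto.
by exists x; rewrite ?inE.
Qed.

Lemma edge_rel_sym E : symmetric (edge_rel E).
Proof. by move=> x y; rewrite /edge_rel /= setUC. Qed.

Lemma mem_edges x y : ([set x; y] \in edges X) = adj x y.
Proof.
apply/imset2P/idP => [[a b _]|axy]; last by exists x y; rewrite ?inE.
by rewrite inE => ab /eqP/set2_eqP[[-> ->]|[-> ->]] //; rewrite adj_sym.
Qed.

Lemma parent_edges_connected f :
  f \in parent_funs -> edges_connected (parent_edges f).
Proof.
case/parent_funsP => fe _ /rank_acyclic_on[d _ df].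
have conn x : connect (edge_rel (parent_edges f)) x e.
  have [n] := ubnP (d x); elim: n x => // n IHn x; rewrite ltnS => dn.
  have [->|nx] := eqVneq x e; first exact: connect0.
  apply: (@connect_trans _ _ (f x)); last by apply/IHn/(leq_trans _ dn)/df.
  by apply: connect1; apply/parent_edgesP; left.
apply/forallP => x; apply/forallP => y; apply: connect_trans (conn x) _.
by rewrite (sym_connect_sym (@edge_rel_sym _)).
Qed.

(* On a cycle, both neighbours of a vertex of maximal rank would have to be *)
(* its parent.                                                              *)
Lemma parent_edges_acyclic f :
  f \in parent_funs -> edges_acyclic (parent_edges f).
Proof.
case/parent_funsP => fe _ /rank_acyclic_on[d de df].
apply/edges_acyclicP => c /andP[cyc Uc]; rewrite leqNgt; apply/negP => c3.
have [x0 cx0] : exists x, x \in c by case: (c) c3 => // a l _; exists a; rewrite mem_head.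
have [x cx maxx] := arg_maxnP d cx0.
have par y : y \in c -> edge_rel (parent_edges f) x y -> y = f x.
  move=> cy /parent_edgesP[[//]|[ny xE]].
  by have := maxx _ cy; rewrite /= leqNgt xE df.
have [k c' rc] := rot_to cx.
move: cyc Uc c3; rewrite -(rot_cycle k) -(rot_uniq k) -(size_rot k) rc.
have: {subset x :: c' <= c} by move=> y; rewrite -rc mem_rot.
case: c' {rc} => [|y [|z s]] // sc /=; rewrite rcons_path /=.
case/and3P=> xy _ /andP[_ lx] /and3P[_ y_zs _] _.
have yE: y = f x by apply: par => //; apply: sc; rewrite !inE eqxx orbT.
have lE: last z s = f x.
  by apply: par; [apply: sc; rewrite 2!inE mem_last !orbT | rewrite edge_rel_sym].
by move: y_zs; rewrite yE -lE mem_last.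
Qed.

(** Induction on the rank for [f]. The edge from [x] to [f x] is an edge of [g]; if [g] oriented it
    from [f x] to [x], then, both functions agreeing at [f x] by induction, [x] would have smaller
    rank than [f x]. *)
Lemma parent_edges_inj : {in parent_funs &, injective parent_edges}.
Proof.
move=> f g /parent_funsP[fe fa /rank_acyclic_on[d de df]] /parent_funsP[ge _ _] Efg.
apply/ffunP => x; have [n] := ubnP (d x); elim: n x => // n IHn x; rewrite ltnS => dn.
have [->|nx] := eqVneq x e; first by rewrite fe ge.
have dfx := df _ nx; have IHf := IHn _ (leq_trans dfx dn).
have : [set x; f x] \in parent_edges g by rewrite -Efg; apply/parent_edgesP; left.
case/parent_edgesP => -[// nfx]; rewrite -IHf => xE.
by have := ltn_trans (df _ nfx) dfx; rewrite -xE ltnn.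
Qed.

(** The parent is a neighbour nearer to the root, [d] being the length of a shortest walk from [e]
    in [E]. An edge of [E] that is not a parent edge would close a cycle with the path joining its
    ends through parent edges. *)
Lemma spanning_tree_parent_edges E :
  spanning_tree E -> exists2 f, f \in parent_funs & E = parent_edges f.
Proof.
case/and3P => /subsetP sE conE /edges_acyclicP acE.
have adjE x y : edge_rel E x y -> adj x y by move/sE; rewrite mem_edges.
pose walk k x := [exists p : k.-tuple X, path (edge_rel E) e p && (last e p == x)].
have walkE x : exists k, walk k x.
  have /connectP[p ep ->] := forallP (forallP conE e) x.
  by exists (size p); apply/existsP; exists (in_tuple p); rewrite ep eqxx.
pose d x := ex_minn (walkE x).
have de : d e = 0.
  rewrite /d; case: ex_minnP => m _ /(_ 0); rewrite leqn0 => m0; apply/eqP/m0.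
  by apply/existsP; exists (in_tuple [::]) => /=.
have step x : x != e -> exists y, edge_rel E x y && (d y < d x).
  rewrite {2}/d; case: ex_minnP => m /existsP[p /andP[ep /eqP lx]] _ nx.
  case/lastP: (val p) (size_tuple p) ep lx => [_ _ /= ex|p' y].
    by rewrite ex eqxx in nx.
  rewrite size_rcons rcons_path last_rcons => <- /andP[ep' lp'] <-.
  exists (last e p'); rewrite edge_rel_sym lp' ltnS /d; case: ex_minnP => k _; apply.
  by apply/existsP; exists (in_tuple p'); rewrite ep' eqxx.
(* No point is nearer than [e] itself, so the default value makes the root a fixed point. *)
pose f := [ffun x => odflt e [pick y | edge_rel E x y && (d y < d x)]].
have fE x : x != e -> edge_rel E x (f x) /\ d (f x) < d x.
  move=> nx; rewrite ffunE; case: pickP => [y /andP[]|] //.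
  by have [y yP] := step x nx => /(_ y); rewrite yP.
have fe : f e = e.
  by rewrite ffunE; case: pickP => //= y; rewrite de ltn0 andbF.
have Pf : f \in parent_funs.
  apply/parent_funsP; split => // [x /fE[/adjE]//|].
  by apply: (@acyclic_on_rank _ _ _ d) => x; rewrite !inE => /fE[].
have sfE : parent_edges f \subset E.
  by apply/subsetP => _ /imsetP[x nx ->]; rewrite !inE in nx; case: (fE x nx).
exists f => //; apply/eqP; rewrite eqEsubset sfE andbT.
apply/subsetP => u Eu; have /imset2P[a b _ _ ab_def] := sE _ Eu.
rewrite {u}ab_def in Eu *; have ab : adj a b by rewrite -mem_edges sE.
apply/negPn/negP => nfab.
have /connectP[p0 pp0 lp0] := forallP (forallP (parent_edges_connected Pf) a) b.
case: (shortenP pp0) lp0 => p pp Up _ lp.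
have pE : path (edge_rel E) a p.
  by apply: sub_path pp => x y; apply: (subsetP sfE).
have /acE : ucycle (edge_rel E) (a :: p).
  by rewrite /ucycle Up /= rcons_path pE -lp andbT edge_rel_sym.
(* A path of length 0 would make the edge a loop; one of length 1 would be the edge itself. *)
case: p lp pp {Up pE} => [ba|c [|//]] /=.
  by rewrite ba adj_irr in ab.
by move=> <- /andP[]; rewrite /edge_rel /= (negPf nfab).
Qed.

Lemma num_spanning_treesE : num_spanning_trees X = #|parent_funs|.
Proof.
rewrite -(card_in_imset parent_edges_inj); apply: eq_card => E; rewrite inE.
apply/idP/imsetP => [/spanning_tree_parent_edges[f Pf ->]|[f Pf ->]]; first by exists f.
rewrite /spanning_tree parent_edges_connected ?parent_edges_acyclic // !andbT.
case/parent_funsP: Pf => _ fa _.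
by apply/subsetP => _ /imsetP[x nx ->]; rewrite mem_edges fa //; rewrite !inE in nx.
Qed.

End SpanningTrees.

(** * Invariance under isomorphism *)

Lemma num_spanning_trees_iso (X Y : sgraph) (h : X -> Y) (e : X) :
    bijective h -> (forall x y, adj (h x) (h y) = adj x y) ->
  num_spanning_trees X = num_spanning_trees Y.
Proof.
case=> k hK kH hadj; rewrite (num_spanning_treesE e) (num_spanning_treesE (h e)).
(* Conjugation by [h] carries parent functions rooted at [e] to those rooted at [h e]. *)
pose conj (f : {ffun X -> X}) := [ffun y => h (f (k y))].
have conj_inj : injective conj.
  move=> f g /ffunP fg; apply/ffunP => x.
  by have := fg (h x); rewrite !ffunE hK => /(can_inj hK).
rewrite -(card_imset _ conj_inj); apply: eq_card => g; apply/imsetP/idP.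
  case=> f /parent_funsP[fe fa acf] ->; apply/parent_funsP; split.
  - by rewrite ffunE hK fe.
  - by move=> y ny; rewrite ffunE -{1}[y]kH hadj fa // -(inj_eq (can_inj hK)) kH.
  - apply/acyclic_onP => S sS gS; apply/setP => y; rewrite -[y]kH.
    have S0 : h @^-1: S = set0.
      apply: (acyclic_onP _ _ acf) => [|x]; last by rewrite !inE => /gS; rewrite ffunE hK.
      apply/subsetP => x; rewrite !inE => /(subsetP sS); rewrite !inE.
      by apply: contra => /eqP->.
    by have := in_set0 (k y); rewrite -S0 !inE => ->.
case/parent_funsP=> ge ga acg; exists [ffun x => k (g (h x))]; last first.
  by apply/ffunP => y; rewrite !ffunE !kH.
apply/parent_funsP; split.
- by rewrite ffunE ge hK.
- by move=> x nx; rewrite ffunE -hadj kH ga // (inj_eq (can_inj hK)).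
- apply/acyclic_onP => S sS fS; apply/setP => x; rewrite -[x]hK.
  have S0 : k @^-1: S = set0.
    apply: (acyclic_onP _ _ acg) => [|y]; last by rewrite !inE => /fS; rewrite ffunE kH.
    apply/subsetP => y; rewrite !inE => /(subsetP sS); rewrite !inE.
    by apply: contra => /eqP->; rewrite hK.
  by have := in_set0 (h x); rewrite -S0 !inE => ->.
Qed.

Lemma kappa_isog (gT hT : finGroupType) (G : {group gT}) (H : {group hT}) :
  G \isog H -> kappa G = kappa H.
Proof.
case/isogP=> f injf fG.
have gP (x : [subg G]) : sgval x \in G by apply: subgP.
have fH (x : [subg G]) : f (sgval x) \in H by rewrite -fG; apply: mem_morphim; apply: subgP.
pose h (x : [subg G]) : [subg H] := subg H (f (sgval x)).
have hM : {morph h : x y / (x * y)%g}.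
  move=> x y; apply/val_inj; rewrite [RHS]/= !subgK ?fH ?groupM //.
  by rewrite /= morphM //; apply: gP.
have h_inj : injective h.
  move=> x y /(congr1 sgval); rewrite !subgK // => /(injmP injf) eq_xy.
  by apply/val_inj/eq_xy; apply: gP.
apply: (@num_spanning_trees_iso (commuting_graph G) (commuting_graph H) h 1%g).
  apply: inj_card_bij h_inj _; rewrite !card_sub.
  have -> : #|[pred x | x \in H]| = #|H| by apply: eq_card.
  have -> : #|[pred x | x \in G]| = #|G| by apply: eq_card.
  by rewrite -fG card_injm.
by move=> x y; rewrite /= /comm_adj /= -!hM !(inj_eq h_inj).
Qed.

(** * Counting forests *)

Section Forests.
Variable T : finType.
Implicit Types (A B D R S : {set T}) (f : {ffun T -> T}).

Definition restr D f : {ffun T -> T} := [ffun x => if x \in D then f x else x].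

(** Functions on disjoint domains, normalized to be the identity elsewhere, combine uniquely into
    one function on the union. *)
Lemma card_glue (I : finType) (D : I -> {set T}) (X : I -> {set {ffun T -> T}}) :
    (forall i j x, x \in D i -> x \in D j -> i = j) ->
    (forall i f, f \in X i -> restr (D i) f = f) ->
  #|[set f | (restr (\bigcup_i D i) f == f) && [forall i, restr (D i) f \in X i]]|
    = \prod_i #|X i|.
Proof.
move=> trD XD.
pose Phi f := [ffun i => restr (D i) f].
set F := [set f | _].
have Phi_inj : {in F &, injective Phi}.
  move=> f g; rewrite !inE => /andP[/eqP fD _] /andP[/eqP gD _] /ffunP fg.
  apply/ffunP => x; rewrite -fD -gD !ffunE; case: bigcupP => // -[i _ Dix].
  by have /ffunP/(_ x) := fg i; rewrite !ffunE Dix.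
rewrite -(card_in_imset Phi_inj) -cardsXn; apply: eq_card => h.
apply/imsetP/setXnP => [[f]|Xh].
  by rewrite inE => /andP[_ /forallP Xf] -> i; rewrite ffunE.
pose f := [ffun x => if [pick i | x \in D i] is Some i then h i x else x].
have fD i : restr (D i) f = h i.
  rewrite -[RHS](XD _ _ (Xh i)); apply/ffunP => x; rewrite !ffunE.
  case: ifP => // Dix; case: pickP => [j Djx|/(_ i)]; last by rewrite Dix.
  by rewrite (trD i j x).
exists f; last by apply/ffunP => i; rewrite ffunE fD.
rewrite inE; apply/andP; split; last by apply/forallP => i; rewrite fD.
apply/eqP/ffunP => x; rewrite !ffunE; case: bigcupP => // nDx.
by case: pickP => // i Dix; case: nDx; exists i.
Qed.

(* Parent functions on D with roots R; the identity is a junk value outside D. *)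
Definition forests D R : {set {ffun T -> T}} :=
  [set f | [&& restr D f == f, [forall x in D, f x \in D :|: R] & acyclic_on D f]].

Lemma forestsP D R f :
  reflect [/\ restr D f = f, {in D, forall x, f x \in D :|: R} & acyclic_on D f]
          (f \in forests D R).
Proof.
rewrite inE; apply: (iffP and3P) => -[fD DR ac]; split => //.
- exact/eqP.
- exact/forall_inP.
- exact/eqP.
- exact/forall_inP.
Qed.

Definition maps_to D R : {set {ffun T -> T}} :=
  [set f | (restr D f == f) && [forall x in D, f x \in R]].

Lemma card_maps_to D R : #|maps_to D R| = #|R| ^ #|D|.
Proof.
transitivity #|setXn (fun x => if x \in D then R else [set x])|.
  apply: eq_card => f; rewrite in_setXn inE.
  apply/andP/forallP => [[/eqP fD /forall_inP DR] x|fX].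
    by case: ifP => [/DR//|nDx]; rewrite -fD ffunE nDx set11.
  split; last by apply/forall_inP => x Dx; have := fX x; rewrite Dx.
  apply/eqP/ffunP => x; rewrite ffunE; case: ifP => // nDx.
  by have := fX x; rewrite nDx inE => /eqP.
rewrite cardsXn (bigID (mem D)) /= [X in _ * X]big1 => [|x /negPf->]; last by rewrite cards1.
by rewrite muln1 -prod_nat_const; apply: eq_bigr => x ->.
Qed.

Lemma forests_no_root D : D != set0 -> forests D set0 = set0.
Proof.
move=> nD; apply/setP => f; rewrite !inE; apply/negP => /and3P[_ /forall_inP fD].
move/acyclic_onP/(_ D (subxx _)) => D0; case/eqP: nD; apply: D0 => x /fD.
by rewrite setU0.
Qed.

Lemma setD_subK D S : S \subset D -> D :\: S :|: S = D.
Proof. by move=> sSD; rewrite setUC -{1}(setIidPr sSD) setID. Qed.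

(** When [S] is the set of vertices whose parent is a root, the forest is an arbitrary map from [S]
    to [R] glued to a forest on the other vertices with roots [S]. *)
Lemma card_forests_top D R S : [disjoint D & R] -> S \subset D ->
  #|[set f in forests D R | [set x in D | f x \in R] == S]|
    = #|R| ^ #|S| * #|forests (D :\: S) S|.
Proof.
move=> dDR sSD.
pose I := fun b : bool => if b then S else D :\: S.
pose X := fun b : bool => if b then maps_to S R else forests (D :\: S) S.
have DI : \bigcup_b I b = D.
  by rewrite big_bool /= setDE setUIr setUCr setIT; apply/setUidPr.
rewrite -card_maps_to -[RHS]/(#|X true| * #|X false|) -[RHS](big_bool _ (fun b => #|X b|)).
rewrite -(@card_glue _ I) => [|[] [] x //=|[] f]; last first.
- by case/forestsP.
- by rewrite inE => /andP[/eqP].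
- by rewrite !inE => /andP[/negP].
- by rewrite !inE => ? /andP[/negP].
apply: eq_card => f; rewrite DI !inE -!andbA; congr (_ && _).
have idem A g : restr A (restr A g) = restr A g.
  by apply/ffunP => x; rewrite !ffunE; case: ifP => // ->.
have notR x : x \in D -> x \notin R by move=> Dx; rewrite (disjointFr dDR).
apply/idP/forallP => [/and3P[/forall_inP fD /acyclic_onP acf /eqP eS] [] | fX].
- rewrite inE idem eqxx; apply/forall_inP => x Sx; rewrite ffunE Sx.
  by move: Sx; rewrite -eS inE => /andP[].
- apply/forestsP; split=> [|x Bx|]; first exact: idem.
    rewrite ffunE Bx setD_subK //; case/setDP: Bx => Dx; rewrite -eS inE Dx /=.
    by have := fD _ Dx; rewrite inE => /orP[|->].
  apply/acyclic_onP => U sU fU; apply: acf => [|x Ux].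
    by apply: subset_trans sU _; apply: subsetDl.
  by have := fU _ Ux; rewrite ffunE (subsetP sU).
have := fX true; rewrite inE idem eqxx => /forall_inP fS.
have {fX} /forestsP[_ fDS /acyclic_onP acf] := fX false.
have fSR x : x \in S -> f x \in R by move=> Sx; have := fS _ Sx; rewrite ffunE Sx.
have fnS x : x \in D :\: S -> f x \in D.
  by move=> Bx; have := fDS _ Bx; rewrite ffunE Bx setD_subK.
apply/and3P; split.
- apply/forall_inP => x Dx; rewrite inE; have [/fSR->|nSx] := boolP (x \in S).
    by rewrite orbT.
  by rewrite fnS // inE nSx.
(* A stable set in [D] avoids [S], whose images lie in [R], so the forest on [D :\: S] excludes
   it. *)
- apply/acyclic_onP => U sU fU.
  have sUB : U \subset D :\: S.
    apply/subsetP => x Ux; rewrite inE (subsetP sU) // andbT; apply/negP => /fSR.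
    by apply/negP/notR/(subsetP sU)/fU.
  by apply: acf => // x Ux; rewrite ffunE (subsetP sUB) ?fU.
- apply/eqP/setP => x; rewrite inE; apply/andP/idP => [[Dx]|Sx].
    by apply: contraTT => nSx; rewrite notR // fnS // inE nSx.
  by rewrite fSR // (subsetP sSD).
Qed.

Lemma sum_subsets D (g : nat -> nat) :
  \sum_(S : {set T} | S \subset D) g #|S| = \sum_(j < #|D|.+1) 'C(#|D|, j) * g j.
Proof.
pose p (S : {set T}) : 'I_#|D|.+1 := inord #|S|.
rewrite (partition_big p predT) //=; apply: eq_bigr => j _.
rewrite -cards_draws -sum_nat_cond_const big_mkcond [RHS]big_mkcond /=.
apply: eq_bigr => S _; case: (boolP (S \subset D)) => //= sSD.
rewrite /p -val_eqE /= inordK ?ltnS ?subset_leq_card //.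
by case: eqP => // ->.
Qed.

(* Cayley's formula |R| (|D| + |R|)^(|D| - 1), multiplied by |D| + |R| because *)
(* the exponent would be truncated for empty D. The induction classifies the  *)
(* forests by the set S of vertices attached to a root: D :\: S is a forest    *)
(* with roots S, and the sum over S is a binomial expansion.                  *)
Theorem card_forests D R : [disjoint D & R] ->
  #|forests D R| * (#|D| + #|R|) = #|R| * (#|D| + #|R|) ^ #|D|.
Proof.
have [n] := ubnP #|D|; elim: n D R => // n IHn D R; rewrite ltnS => leDn dDR.
have [->|nD] := eqVneq D set0.
  rewrite cards0 expn0 muln1 add0n -[RHS]mul1n; congr (_ * _).
  apply/eqP/cards1P; exists [ffun x => x]; apply/setP => f; rewrite [RHS]inE.
  apply/forestsP/eqP => [[<- _ _]|->].
    by apply/ffunP => x; rewrite !ffunE inE.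
  split=> [|x|]; rewrite ?inE //; first by apply/ffunP => x; rewrite !ffunE inE.
  by apply/acyclic_onP => S; rewrite subset0 => /eqP.
have D_gt0 : 0 < #|D| by rewrite card_gt0.
have top S : S \subset D ->
    #|[set f in forests D R | [set x in D | f x \in R] == S]| * #|D|
      = #|R| ^ #|S| * (#|S| * #|D| ^ (#|D| - #|S|)).
  move=> sSD; rewrite card_forests_top // -mulnA; congr (_ * _).
  have [->|nS] := eqVneq S set0; first by rewrite setD0 forests_no_root // !cards0.
  have cDS : #|D :\: S| = #|D| - #|S| by rewrite cardsD (setIidPr sSD).
  have := IHn (D :\: S) S; rewrite cDS subnK ?subset_leq_card //; apply.
    by rewrite (leq_trans _ leDn) // ltn_subrL D_gt0 card_gt0 nS.
  by rewrite disjoints_subset setDE subsetIr.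
(* The extra factor [#|D|] is the one that the induction hypothesis needs in each summand: [D :\: S]
   and [S] together have [#|D|] elements. *)
apply/eqP; rewrite -(eqn_pmul2r D_gt0) mulnAC; apply/eqP.
rewrite -sum1_card (partition_big (fun f => [set x in D | f x \in R])
  (fun S => S \subset D)) /=;
  last by move=> f _; apply/subsetP => x; rewrite inE => /andP[].
rewrite big_distrl /=.
under eq_bigr => S sS.
  rewrite (_ : \sum_(_ | _) _ = #|[set f in forests D R | [set x in D | f x \in R] == S]|).
    rewrite top //. over.
  by rewrite sum1dep_card; apply: eq_card => f; rewrite !inE.
rewrite (sum_subsets D (fun j => #|R| ^ j * (j * #|D| ^ (#|D| - j)))).
case: #|D| D_gt0 => // d _; rewrite big_ord_recl /=.
rewrite mul0n !muln0 add0n expnSr [in RHS]mulnA [RHS]mulnAC; congr (_ * _).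
rewrite expnDn big_distrr big_distrl /=; apply: eq_bigr => i _.
rewrite /bump add1n subSS expnS.
set a := d.+1 ^ _; set b := #|R| ^ _.
transitivity (#|R| * b * a * (i.+1 * 'C(d.+1, i.+1))).
  by rewrite /b; ring.
(* The absorption identity matches the terms for nonempty [S] with the binomial expansion. *)
rewrite -mul_bin_diag /=.
by ring.
Qed.

End Forests.

(** * Groups with abelian centralizers *)

Section CentralizerProduct.
Variable sT : finGroupType.
Local Open Scope group_scope.
Hypothesis abC : forall x : sT, x != 1 -> abelian 'C[x].
Implicit Types (x y : sT) (B : {set sT}).

Definition centralizers : {set {set sT}} := [set 'C[x] | x in [set~ 1]].

Lemma cent1_eq x y : x != 1 -> y != 1 -> x \in 'C[y] -> 'C[x] = 'C[y].
Proof.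
move=> nx ny Cxy; have Cyx : y \in 'C[x] by rewrite cent1C.
apply/eqP; rewrite eqEsubset !sub_cent1.
by rewrite (subsetP (abC nx)) // (subsetP (abC ny)).
Qed.

(** Indexed by all sets, as [card_glue] takes a finite type of indices; a set that is not a
    centralizer gets the empty block, which carries exactly one forest. *)
Let D B := if B \in centralizers then B :\ 1 else set0.

Let memD B x : (x \in D B) = (x != 1) && (B == 'C[x]).
Proof.
rewrite /D; case: ifP => [/imsetP[y]|nB]; rewrite !inE.
  move=> ny ->; have [//|nx] /= := eqVneq x 1; rewrite eq_sym.
  apply/idP/eqP => [xy|<-]; last exact: cent1id.
  exact: cent1_eq.
apply/esym/andP => -[nx /eqP BE]; case/imsetP: nB; exists x => //; by rewrite !inE.
Qed.

Let cover_D : \bigcup_B D B = [set~ 1].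
Proof.
apply/setP => x; rewrite !inE; apply/bigcupP/idP => [[B _]|nx].
  by rewrite memD => /andP[].
by exists 'C[x]; rewrite // memD nx eqxx.
Qed.

Let parent_fun := fun f : {ffun sT -> sT} =>
  [/\ f 1 = 1, forall x, x != 1 -> x != f x /\ f x \in 'C[x] & acyclic_on [set~ 1] f].

(** A neighbour of [x] other than 1 has the same centralizer, so the parent of [x] is 1 or in its
    block. Conversely, a nonempty stable set avoiding 1 would meet some block in a nonempty stable
    set. *)
Let parent_funE f : parent_fun f <->
  restr [set~ 1] f = f /\ forall B, restr (D B) f \in forests (D B) [set 1].
Proof.
split=> [[f1 fC /acyclic_onP acf] | [fD fF]].
  split=> [|B].
    by apply/ffunP => x; rewrite ffunE !inE; case: eqP => [->|].
  apply/forestsP; split=> [|x Dx|].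
  - by apply/ffunP => x; rewrite !ffunE; case: ifP => // ->.
  - rewrite ffunE Dx; move: Dx; rewrite inE orbC inE memD => /andP[nx /eqP->].
    case: eqP => //= /eqP nfx; rewrite memD nfx; apply/eqP.
    by case: (fC x nx) => _ Cfx; rewrite (cent1_eq nfx nx).
  - apply/acyclic_onP => U sU fU; apply: acf => [|x Ux].
      by apply: subset_trans sU _; rewrite -cover_D (bigcup_max B).
    by have := fU _ Ux; rewrite ffunE (subsetP sU).
have fB x : x != 1 -> [/\ f x \in 'C[x],
    acyclic_on (D 'C[x]) (restr (D 'C[x]) f) & x \in D 'C[x]].
  move=> nx; have Dx : x \in D 'C[x] by rewrite memD nx eqxx.
  case/forestsP: (fF 'C[x]) => _ /(_ x Dx) fx acx; split=> //.
  move: fx; rewrite ffunE Dx inE orbC inE; case: eqP => [->|_]; first by rewrite group1.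
  by rewrite memD => /andP[_ /eqP->]; rewrite cent1id.
have acf : acyclic_on [set~ 1] f.
  apply/acyclic_onP => U sU fU; apply/eqP/set0Pn => -[x Ux].
  have nx y : y \in U -> y != 1 by move/(subsetP sU); rewrite !inE.
  have [_ /acyclic_onP/(_ (U :&: D 'C[x])) acx Dx] := fB x (nx x Ux).
  have := in_set0 x; rewrite -acx ?inE ?Ux ?Dx //; first exact: subsetIr.
  move=> y /setIP[Uy Dy]; rewrite ffunE Dy inE fU //= memD nx ?fU //=.
  move: Dy; rewrite memD => /andP[ny /eqP ->].
  by have [Cfy _ _] := fB y ny; rewrite (cent1_eq _ ny) ?nx ?fU.
split=> // [|x nx]; first by rewrite -fD ffunE !inE eqxx.
split; last by case: (fB x nx).
(* A fixed point would be a stable singleton. *)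
apply/eqP => xfx; have := in_set0 x; rewrite -(acyclic_onP _ _ acf [set x]) ?set11 //.
  by rewrite sub1set !inE.
by move=> y; rewrite !inE => /eqP->; rewrite -xfx.
Qed.

Lemma card_parent_funs_centralizers :
  #|[set f : {ffun sT -> sT} | [&& f 1 == 1,
       [forall x, (x != 1) ==> (x != f x) && (x * f x == f x * x)]
     & acyclic_on [set~ 1] f]]| = (\prod_(B in centralizers) #|B| ^ (#|B| - 2))%N.
Proof.
transitivity (\prod_B #|forests (D B) [set 1%g]|)%N.
  rewrite -(card_glue (D := D)); first 1 last.
  - by move=> B B' x; rewrite !memD => /andP[_ /eqP->] /andP[_ /eqP->].
  - by move=> B f /forestsP[].
  apply: eq_card => f; rewrite cover_D !inE; apply/and3P/andP => [[/eqP f1 /forallP fC acf]|].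
    have /parent_funE[fD fF] : parent_fun f.
      split=> // x nx; have /implyP/(_ nx)/andP[-> /eqP Cx] := fC x; split=> //.
      by apply/cent1P.
    by rewrite fD eqxx; split=> //; apply/forallP.
  case=> /eqP fD /forallP fF; have /parent_funE[f1 fC acf] := conj fD fF.
  rewrite f1 eqxx; split=> //; apply/forallP => x; apply/implyP => /fC[-> /cent1P ->].
  exact: eqxx.
rewrite [RHS]big_mkcond; apply: eq_bigr => B _.
have := @card_forests _ (D B) [set 1]; rewrite disjoint_sym disjoints1 memD eqxx cards1.
move/(_ isT); rewrite mul1n /D; case: ifP => [|_]; last by rewrite cards0 add0n muln1.
case/imsetP => x; rewrite !inE => nx ->.
have -> : #|'C[x]^#| = #|'C[x]|.-1 by rewrite (cardsD1 1 'C[x]) group1.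
rewrite addn1 prednK ?cardG_gt0 //.
(* The centralizer contains 1 and [x], so subtracting 2 is not truncated and Cayley's formula can be
   divided by the order. *)
have : (1 < #|'C[x]|)%N.
  by rewrite cardG_gt1; apply/trivgPn; exists x => //; apply: cent1id.
case: #|'C[x]| => [|[|m]] // _; rewrite !subSS subn0 /= expnSr => /eqP.
by rewrite eqn_pmul2r // => /eqP.
Qed.

(** Each centralizer of order [c] accounts for [c - 1] nontrivial elements, so the quotient is the
    number of such centralizers. Orders in [r] that do not occur give factors 1. *)
Lemma prod_centralizers (r : seq nat) :
    uniq r -> (forall x, x != 1 -> #|'C[x]| \in r) ->
  (\prod_(B in centralizers) #|B| ^ (#|B| - 2)
  = \prod_(c <- r) c ^ ((c - 2) *
      (#|[set x : sT | (x != 1) && (#|'C[x]| == c)]%g| %/ (c - 1))))%N.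
Proof.
move=> Ur rC.
transitivity (\prod_(B in centralizers) \prod_(c <- r | c == #|B|) c ^ (c - 2))%N.
  apply: eq_bigr => _ /imsetP[x nx ->]; rewrite !inE in nx *.
  rewrite big_mkcond (bigD1_seq _ (rC _ nx) Ur) /= eqxx big1 ?muln1 // => c.
  by move/negPf->.
rewrite (exchange_big_dep predT) //=; apply: eq_bigr => c _.
pose Cc := [set B in centralizers | #|B| == c].
transitivity (c ^ ((c - 2) * #|Cc|))%N.
  rewrite expnM -prod_nat_const; apply: eq_bigl => B.
  by rewrite inE [c == _]eq_sym.
have [c2|c2] := leqP c 2; first by rewrite (eqP c2) !mul0n.
congr (_ ^ (_ * _))%N; have c1 : (0 < c - 1)%N by rewrite subn_gt0 ltnW.
rewrite -(mulnK #|Cc| c1); congr (_ %/ _)%N.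
apply: esym; rewrite -sum1dep_card (partition_big (fun x => 'C[x]) (mem Cc)) /=; last first.
  by move=> x /andP[nx Cx]; rewrite inE Cx andbT; apply: imset_f; rewrite !inE.
rewrite -sum_nat_const; apply: eq_bigr => B; rewrite !inE => /andP[CB /eqP cB].
have -> : (c - 1)%N = #|D B|.
  have B1 : 1 \in B by case/imsetP: CB => x _ ->; apply: group1.
  by rewrite /D CB -cB (cardsD1 1 B) B1 addKn.
rewrite sum1dep_card; apply: eq_card => x; rewrite memD inE -andbA [B == _]eq_sym.
congr (_ && _); case: ('C[x] =P B) => [CxB|_]; last by rewrite andbF.
by rewrite andbT -cB -CxB eqxx.
Qed.

End CentralizerProduct.

(** The vertices have type [[subg G]], whose full centralizers correspond to the centralizers in
    [G]. *)
Theorem kappa_centralizers (gT : finGroupType) (G : {group gT}) (r : seq nat) :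
    {in G, forall x, x != 1%g -> abelian 'C_G[x]} ->
    uniq r -> {in G, forall x, x != 1%g -> #|'C_G[x]%g| \in r} ->
  kappa G = \prod_(c <- r) c ^ ((c - 2) *
    (#|[set x in G | (x != 1%g) && (#|'C_G[x]%g| == c)]| %/ (c - 1))).
Proof.
move=> abC Ur rC; rewrite /kappa.
rewrite (num_spanning_treesE (X := commuting_graph G) (1%g : [subg G])).
have CE (x : [subg G]) : 'C_G[sgval x]%g = sgval @: 'C[x]%g.
  apply/setP => y; apply/setIP/imsetP => [[Gy /cent1P Cxy]|[z /cent1P Cxz ->]].
    exists (subg G y); last by rewrite /= subgK.
    by apply/cent1P/val_inj; rewrite /= subgK.
  by split; [exact: subgP | apply/cent1P; have := congr1 sgval Cxz].
have cardCE (x : [subg G]) : #|'C[x]%g| = #|'C_G[sgval x]%g|.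
  by rewrite CE card_imset //; apply: subg_inj.
have abCs (x : [subg G]) : x != 1%g -> abelian 'C[x]%g.
  move=> nx; have ab : abelian 'C_G[sgval x].
    by apply: abC; [exact: subgP | rewrite -(inj_eq subg_inj) in nx].
  apply/centsP => y Cy z Cz; apply: subg_inj.
  by apply: (centsP ab); rewrite CE imset_f.
rewrite [LHS](card_parent_funs_centralizers abCs).
rewrite (prod_centralizers abCs Ur) => [|x nx]; last first.
  by rewrite -(inj_eq subg_inj) in nx; rewrite cardCE; apply: rC nx; apply: subgP.
apply: eq_bigr => c _; congr (_ ^ (_ * (_ %/ _))).
rewrite -(card_imset _ (@subg_inj _ G)); apply: eq_card => y; rewrite [RHS]inE.
apply/imsetP/and3P => [[x]|[Gy ny Cy]].
  rewrite inE cardCE -(inj_eq subg_inj) => /andP[nx Cx] ->; split=> //.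
  exact: subgP.
exists (subg G y); last by rewrite /= subgK.
rewrite inE cardCE /= subgK // Cy andbT -(inj_eq subg_inj) /=.
by rewrite subgK.
Qed.

Lemma card_sum_mem (T : finType) (A : {set T}) : #|A| = \sum_x (x \in A).
Proof. by rewrite -sum1_card big_mkcond; apply: eq_bigr => x _; case: ifP. Qed.

(** * Centralizers in SL(2,F) *)

Section TwoByTwo.
Variable F : finFieldType.
Local Open Scope ring_scope.
Import GRing.Theory.
Implicit Types (a b c d t : F) (u v : {'GL_2[F]}).

Definition mx2 a b c d : 'M[F]_2 :=
  \matrix_(i, j) (if i == 0 then if j == 0 then a else b else if j == 0 then c else d).

Lemma mx2P (A : 'M[F]_2) : A = mx2 (A 0 0) (A 0 1) (A 1 0) (A 1 1).
Proof.
apply/matrixP => i j; rewrite mxE.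
by case: i j => [[|[|//]] ip] [[|[|//]] jp] /=; congr (A _ _); apply: val_inj.
Qed.

Lemma mx2_inj a b c d a' b' c' d' :
  mx2 a b c d = mx2 a' b' c' d' -> [/\ a = a', b = b', c = c' & d = d'].
Proof.
move=> /matrixP eqA; split.
- by have := eqA 0 0; rewrite !mxE.
- by have := eqA 0 1; rewrite !mxE.
- by have := eqA 1 0; rewrite !mxE.
- by have := eqA 1 1; rewrite !mxE.
Qed.

Lemma mul_mx2 a b c d a' b' c' d' :
  mx2 a b c d *m mx2 a' b' c' d' =
  mx2 (a * a' + b * c') (a * b' + b * d') (c * a' + d * c') (c * b' + d * d').
Proof.
apply/matrixP => i j; rewrite !mxE big_ord_recl big_ord1 !mxE.
by case: i j => [[|[|//]] ip] [[|[|//]] jp].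
Qed.

Lemma det_mx2 a b c d : \det (mx2 a b c d) = a * d - b * c.
Proof.
rewrite (expand_det_row _ 0) big_ord_recl big_ord1 /cofactor !det_mx11 !mxE /=.
by rewrite expr0 expr1 mul1r mulN1r mulrN.
Qed.

Lemma tr_mx2 a b c d : \tr (mx2 a b c d) = a + d.
Proof. by rewrite /mxtrace big_ord_recl big_ord1 !mxE. Qed.

Lemma scalar_mx2 a : a%:M = mx2 a 0 0 a.
Proof.
apply/matrixP => i j; rewrite !mxE.
by case: i j => [[|[|//]] ip] [[|[|//]] jp].
Qed.

(** The identity is a default for singular matrices; the lemmas below ask for determinant 1. *)
Definition sl2 a b c d : {'GL_2[F]} := insubd (1%g : {'GL_2[F]}) (mx2 a b c d).

Lemma sl2E a b c d : a * d - b * c = 1 -> GLval (sl2 a b c d) = mx2 a b c d.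
Proof.
move=> det1; rewrite /sl2 /insubd insubT //= unitmxE det_mx2 det1; exact: unitr1.
Qed.

Lemma SL2_sl2 a b c d : a * d - b * c = 1 -> sl2 a b c d \in SL 2 F.
Proof. by move=> det1; rewrite inE sl2E // det_mx2 det1. Qed.

Variant SL2_spec : {'GL_2[F]} -> Prop :=
  SL2Spec a b c d of a * d - b * c = 1 : SL2_spec (sl2 a b c d).

Lemma SL2P u : u \in SL 2 F -> SL2_spec u.
Proof.
rewrite inE => /eqP; rewrite [in \det _](mx2P u) det_mx2 => det1.
have -> : u = sl2 (GLval u 0 0) (GLval u 0 1) (GLval u 1 0) (GLval u 1 1).
  by apply: val_inj; rewrite [RHS]sl2E // [LHS](mx2P u).
by constructor.
Qed.

Lemma sl2_inj a b c d a' b' c' d' :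
    a * d - b * c = 1 -> a' * d' - b' * c' = 1 ->
  sl2 a b c d = sl2 a' b' c' d' -> [/\ a = a', b = b', c = c' & d = d'].
Proof. by move=> D D' /(congr1 (@GLval _ _)); rewrite !sl2E // => /mx2_inj. Qed.

Lemma sl2_mul a b c d a' b' c' d' :
    a * d - b * c = 1 -> a' * d' - b' * c' = 1 ->
  (sl2 a b c d * sl2 a' b' c' d')%g =
  sl2 (a * a' + b * c') (a * b' + b * d') (c * a' + d * c') (c * b' + d * d').
Proof.
move=> D D'; apply: val_inj; rewrite [LHS]GL_MxE sl2E // sl2E // mul_mx2 [RHS]sl2E //.
transitivity ((a * d - b * c) * (a' * d' - b' * c')); first by ring.
by rewrite D D' mul1r.
Qed.

Lemma sl2_1 : sl2 1 0 0 1 = 1%g.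
Proof. by apply: val_inj; rewrite [LHS]sl2E ?mulr1 ?mul0r ?subr0 // -scalar_mx2. Qed.

(** A matrix commuting with a non-scalar 2 by 2 matrix is a polynomial in it: [(b', c', a' - d')] is
    proportional to [(b, c, a - d)], and [r] is the ratio at a nonzero coordinate. *)
Lemma sl2_commute a b c d a' b' c' d' :
    a * d - b * c = 1 -> a' * d' - b' * c' = 1 ->
    [|| b != 0, c != 0 | a != d] ->
    sl2 a' b' c' d' \in 'C[sl2 a b c d]%g ->
  exists s r, [/\ a' = s + r * a, b' = r * b, c' = r * c & d' = s + r * d].
Proof.
move=> D D' nsc /cent1P; rewrite /commute !sl2_mul // => /sl2_inj[].
- transitivity ((a' * d' - b' * c') * (a * d - b * c)); first by ring.
  by rewrite D D' mul1r.
- transitivity ((a * d - b * c) * (a' * d' - b' * c')); first by ring.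
  by rewrite D D' mul1r.
move=> E1 E2 E3 E4.
have bc : b' * c = b * c' by apply: (addrI (a' * a)); rewrite E1; ring.
have {E2} ab : b' * (a - d) = b * (a' - d').
  apply/eqP; rewrite -subr_eq0; move/eqP: E2; rewrite -subr_eq0 => /eqP E2.
  by apply/eqP; rewrite -oppr0 -E2; ring.
have {E3} ac : c' * (a - d) = c * (a' - d').
  apply/eqP; rewrite -subr_eq0; move/eqP: E3; rewrite -subr_eq0 => /eqP E3.
  by apply/eqP; rewrite -E3; ring.
case/or3P: nsc => [b0|c0|nad].
- exists (a' - b' / b * a), (b' / b); split; first by ring.
  + by rewrite divfK.
  + by rewrite mulrAC bc mulrAC mulfV // mul1r.
  + by have -> : d' = a' - b' * (a - d) / b; [rewrite ab; field | field].
- exists (a' - c' / c * a), (c' / c); split; first by ring.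
  + by rewrite mulrAC [c' * b]mulrC -bc mulfK.
  + by rewrite divfK.
  + by have -> : d' = a' - c' * (a - d) / c; [rewrite ac; field | field].
have ad0 : a - d != 0 by rewrite subr_eq0.
exists (a' - (a' - d') / (a - d) * a), ((a' - d') / (a - d)); split; first by ring.
- by rewrite mulrAC [_ * b]mulrC -ab mulfK.
- by rewrite mulrAC [_ * c]mulrC -ac mulfK.
- by field.
Qed.

Lemma abelian_cent_sl2 a b c d : a * d - b * c = 1 ->
  [|| b != 0, c != 0 | a != d] -> abelian 'C_(SL 2 F)[sl2 a b c d]%g.
Proof.
move=> D nsc; apply/centsP => y /setIP[/SL2P[a1 b1 c1 d1 D1] C1].
move=> z /setIP[/SL2P[a2 b2 c2 d2 D2] C2].
rewrite /commute !sl2_mul //.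
have [s1 [r1 [-> -> -> ->]]] := sl2_commute D D1 nsc C1.
have [s2 [r2 [-> -> -> ->]]] := sl2_commute D D2 nsc C2.
by congr (sl2 _ _ _ _); ring.
Qed.

(** The form is the determinant of s + r x for [x] of determinant 1 and trace [t]. *)
Definition norm1_pairs t : {set F * F} :=
  [set p | p.1 ^+ 2 + t * p.1 * p.2 + p.2 ^+ 2 == 1].

(* By Cayley-Hamilton the centralizer consists of the s + r x of norm 1. *)
Lemma card_cent_sl2 a b c d : a * d - b * c = 1 ->
  [|| b != 0, c != 0 | a != d] ->
  #|'C_(SL 2 F)[sl2 a b c d]%g| = #|norm1_pairs (a + d)|.
Proof.
move=> D nsc.
pose h (p : F * F) := sl2 (p.1 + p.2 * a) (p.2 * b) (p.2 * c) (p.1 + p.2 * d).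
have hD p : p \in norm1_pairs (a + d) ->
    (p.1 + p.2 * a) * (p.1 + p.2 * d) - (p.2 * b) * (p.2 * c) = 1.
  rewrite inE => /eqP <-; rewrite -[p.2 ^+ 2]mulr1 -D; ring.
have h_inj : {in norm1_pairs (a + d) &, injective h}.
  move=> [s r] [s' r'] /hD P /hD P' /(sl2_inj P P')[/= Ea Eb Ec Ed].
  suff rr : r = r' by rewrite rr in Ea *; rewrite (addIr _ Ea).
  case/or3P: nsc => [b0|c0|nad]; [exact: mulIf Eb | exact: mulIf Ec |].
  have ad0 : a - d != 0 by rewrite subr_eq0.
  apply: (mulIf ad0); rewrite !mulrBr.
  transitivity (s + r * a - (s + r * d)); first by ring.
  by rewrite Ea Ed; ring.
rewrite -(card_in_imset h_inj); apply: eq_card => y; apply/setIP/imsetP.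
  case=> /SL2P[a' b' c' d' D'] /(sl2_commute D D' nsc)[s [r [Ea Eb Ec Ed]]].
  exists (s, r); last by rewrite Ea Eb Ec Ed.
  by rewrite inE -D' Ea Eb Ec Ed /= -[r ^+ 2]mulr1 -D; apply/eqP; ring.
case=> p /hD P ->; split; first exact: SL2_sl2.
by apply/cent1P; rewrite /commute !sl2_mul //; congr (sl2 _ _ _ _); ring.
Qed.

(** The norm form vanishes at [(r, 1)]; in characteristic 2 these are the eigenvalues in [F] of
    elements of SL(2,F) of trace [t]. *)
Definition reciprocal_roots t : {set F} := [set r | r ^+ 2 + t * r + 1 == 0].

End TwoByTwo.

(** * Traces and centralizer orders in characteristic 2 *)

Section CharacteristicTwo.
Variables (F : finFieldType) (n : nat).
Hypotheses (n_gt1 : 1 < n) (cardF : #|F| = (2 ^ n)%N).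
Local Open Scope ring_scope.
Import GRing.Theory.
Implicit Types (a b c d t r s : F).

Let q := #|F|.
Local Notation roots := (@reciprocal_roots F).

Let char2 : 2 \in [pchar F].
Proof. exact: card_finPcharP cardF _. Qed.

Let oppF r : - r = r.
Proof. exact: oppr_pchar2. Qed.

Let addFF r : r + r = 0.
Proof. exact: addrr_pchar2. Qed.

Let q_gt1 : (1 < q)%N.
Proof. exact: finNzRing_gt1. Qed.

Let sqrD r s : (r + s) ^+ 2 = r ^+ 2 + s ^+ 2.
Proof. by rewrite sqrrD mulr2n addFF addr0. Qed.

Let sqr_inj r s : r ^+ 2 = s ^+ 2 -> r = s.
Proof.
move=> rs; apply/eqP; rewrite -subr_eq0 oppF -sqrf_eq0 sqrD rs addFF //.
Qed.

Let sqrt_ex r : exists s, s ^+ 2 = r.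
Proof.
exists (r ^+ (2 ^ n.-1)); rewrite -exprM -expnSr prednK ?(ltnW n_gt1) //.
by rewrite -cardF expf_card.
Qed.

(* A point of the projective line off the roots contains exactly one vector *)
(* of norm 1, squaring being bijective.                                     *)
Lemma card_norm1_pairs t : (#|norm1_pairs t| + #|roots t| = q.+1)%N.
Proof.
pose h (p : F * F) := if p.2 == 0 then None else Some (p.1 / p.2).
have normE a b : b != 0 ->
    a ^+ 2 + t * a * b + b ^+ 2 = ((a / b) ^+ 2 + t * (a / b) + 1) * b ^+ 2.
  by move=> b0; field.
have h_inj : {in norm1_pairs t &, injective h}.
  move=> [a b] [a' b']; rewrite !inE /h /= => /eqP N /eqP N'.
  have [b0|b0] := eqVneq b 0; have [b0'|b0'] := eqVneq b' 0 => //.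
    move=> _; rewrite b0 b0' in N N' *; congr (_, _); apply: sqr_inj.
    by move: N N'; rewrite !mulr0 expr0n /= !addr0 => -> ->.
  case=> eq_ab; rewrite normE // eq_ab in N; rewrite normE // in N'.
  have bb : b = b'.
    pose k := (a' / b') ^+ 2 + t * (a' / b') + 1; rewrite -/k in N N'.
    have k0 : k != 0 by apply/eqP => E0; move/eqP: N; rewrite E0 mul0r eq_sym oner_eq0.
    by apply/sqr_inj/(mulfI k0); rewrite N N'.
  by rewrite -[a](divfK b0) eq_ab bb divfK.
have SomeI : injective (@Some F) by move=> ? ? [].
rewrite -(card_in_imset h_inj) -(card_imset _ SomeI) -[RHS]card_option.
rewrite addnC -(cardsC (Some @: roots t)); congr (_ + _)%N.
apply: eq_card => z; rewrite inE; apply/imsetP/idP => [[[a b]]|].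
  rewrite inE /h /= => /eqP N ->; apply/imsetP; case: eqP => [_ [] //|/eqP b0].
  case=> r; rewrite inE => /eqP r0 [rE]; move/eqP: N.
  by rewrite normE // rE r0 mul0r eq_sym oner_eq0.
case: z => [r|_]; last first.
  by exists (1, 0); rewrite ?inE /h /= ?eqxx // mulr0 expr1n expr0n /= !addr0.
rewrite mem_imset; last exact: SomeI.
rewrite inE => nr; have [s sE] := sqrt_ex (r ^+ 2 + t * r + 1)^-1.
have s0 : s != 0 by rewrite -sqrf_eq0 sE invr_eq0.
exists (r * s, s); last by rewrite /h /= (negPf s0) mulfK.
by rewrite inE /= normE // mulfK // sE mulfV.
Qed.

(** With diagonal [a], [a + t], determinant 1 means that [b * c] equals [a ^+ 2 + t * a + 1]. For
    each [a] this has q - 1 solutions, and q more when the right side is 0. *)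
Lemma card_trace t :
  #|[set u in SL 2 F | \tr (GLval u) == t]| = (q * (q.-1 + #|roots t|))%N.
Proof.
pose N : {set F * (F * F)} :=
  [set p | p.2.1 * p.2.2 == p.1 ^+ 2 + t * p.1 + 1].
pose h (p : F * (F * F)) := sl2 p.1 p.2.1 p.2.2 (p.1 + t).
have hD p : p \in N -> p.1 * (p.1 + t) - p.2.1 * p.2.2 = 1.
  rewrite inE => /eqP->; rewrite oppF.
  transitivity (1 + (p.1 ^+ 2 + t * p.1 + (p.1 ^+ 2 + t * p.1))); first by ring.
  by rewrite addFF addr0.
have h_inj : {in N &, injective h}.
  move=> [a [b c]] [a' [b' c']] /hD P /hD P' /(sl2_inj P P')[/= Ea Eb Ec _].
  by rewrite Ea Eb Ec.
transitivity #|N|.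
  rewrite -(card_in_imset h_inj); apply: eq_card => u; rewrite inE.
  apply/andP/imsetP => [[/SL2P[a b c d D]]|[p /hD P ->]]; last first.
    by rewrite SL2_sl2 // sl2E // tr_mx2 addrA addFF add0r.
  rewrite sl2E // tr_mx2 => /eqP tE; have dE : d = a + t by rewrite -tE addrA addFF add0r.
  exists (a, (b, c)); last by rewrite /h /= -dE.
  rewrite inE /= -[b * c]oppF; apply/eqP/(addrI (a * d)); rewrite D dE.
  by transitivity (1 + (a ^+ 2 + t * a + (a ^+ 2 + t * a))); [rewrite addFF addr0 | ring].
have count (k : F) : (\sum_(b : F) #|[set c | (b * c == k)%R]| = q.-1 + q * (k == 0%R))%N.
  rewrite (bigD1 (0 : F)) //= addnC; congr (_ + _)%N.
    rewrite -[q.-1]muln1 -(cardC1 (0 : F)) -sum_nat_const; apply: eq_bigr => b b0.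
    apply/eqP/cards1P; exists (k / b); apply/setP => c; rewrite !inE.
    by rewrite -[RHS](inj_eq (mulfI b0)) [k / b]mulrC mulVKf.
  have [->|k0] := eqVneq k 0; rewrite /= ?muln1 ?muln0.
    by rewrite /q -cardsT; apply: eq_card => c; rewrite !inE mul0r eqxx.
  by apply: eq_card0 => c; rewrite !inE mul0r eq_sym (negPf k0).
have cardE (T : finType) (A : {set F * T}) : #|A| = (\sum_a \sum_p ((a, p) \in A))%N.
  rewrite (pair_bigA _ (fun a p => ((a, p) \in A) : nat)) -sum1_card big_mkcond /=.
  by apply: eq_bigr => -[a p] _; case: ifP.
rewrite cardE.
transitivity (\sum_(a : F) (q.-1 + q * (a \in roots t)))%N.
  apply: eq_bigr => a _; rewrite inE -count.
  transitivity (\sum_(p : F * F) ((a, (p.1, p.2)) \in N))%N.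
    by apply: eq_bigr => -[].
  rewrite -(pair_bigA _ (fun b c => (a, (b, c)) \in N : nat)) /=.
  apply: eq_bigr => b _; rewrite -sum1_card [RHS]big_mkcond; apply: eq_bigr => c _.
  by rewrite !inE; case: ifP.
rewrite big_split /= sum_nat_const -/q -big_distrr /= -mulnDr; congr (_ * (_ + _))%N.
by rewrite -sum1_card [RHS]big_mkcond; apply: eq_bigr => a _; case: (a \in _).
Qed.

Let roots0 : #|roots 0| = 1%N.
Proof.
apply/eqP/cards1P; exists 1; apply/setP => r; rewrite !inE mul0r addr0.
apply/eqP/eqP => [r1|->]; last by rewrite expr1n addFF.
by apply: sqr_inj; rewrite expr1n -[LHS]oppF; apply/esym/eqP; rewrite -addr_eq0 addrC r1.
Qed.

Let roots_neq0 t : t != 0 -> (#|roots t| == 0)%N || (#|roots t| == 2)%N.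
Proof.
move=> t0; have [->|[r rr]] := set_0Vmem (roots t); first by rewrite cards0.
suff -> : roots t = [set r; r + t].
  by rewrite cards2 -subr_eq0 opprD addrA subrr add0r oppr_eq0 t0.
move: rr; rewrite inE => /eqP r0; apply/setP => s; rewrite !inE -r0.
rewrite -subr_eq0 -[s == r]subr_eq0 -[s == r + t]subr_eq0 -mulf_eq0; congr (_ == 0).
rewrite !oppF.
transitivity (s ^+ 2 + r ^+ 2 + t * (s + r) + (1 + 1)); first by ring.
rewrite addFF addr0 -sqrD; ring.
Qed.

Let card_traces k := #|[set t | #|roots t| == k]|.

Lemma card_roots1 : card_traces 1 = 1%N.
Proof.
apply/eqP/cards1P; exists 0; apply/setP => t; rewrite !inE.
have [->|t0] := eqVneq t 0; first by rewrite roots0.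
by case/orP: (roots_neq0 t0) => /eqP->.
Qed.

Let card_roots_le t : [|| #|roots t| == 0, #|roots t| == 1 | #|roots t| == 2]%N.
Proof.
by have [->|/roots_neq0/orP[]->] := eqVneq t 0; rewrite ?roots0 ?orbT.
Qed.

Lemma card_traces_sum : (card_traces 0 + card_traces 2 = q.-1)%N.
Proof.
suff : (card_traces 0 + card_traces 2 + card_traces 1 = q)%N.
  by rewrite card_roots1 => <-; rewrite addn1.
rewrite /card_traces !card_sum_mem -!big_split /q -cardsT card_sum_mem.
by apply: eq_bigr => t _; rewrite !inE; case/or3P: (card_roots_le t) => /eqP->.
Qed.

(* Double counting of the pairs (r, t) with r a root for t: each nonzero r  *)
(* is a root for exactly one t.                                             *)
Lemma card_traces2 : ((card_traces 2).*2 = q.-2)%N.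
Proof.
have sum_roots : (\sum_t #|roots t| = q.-1)%N.
  transitivity (\sum_t \sum_r (r \in roots t))%N.
    by apply: eq_bigr => t _; rewrite card_sum_mem.
  rewrite exchange_big /= (bigD1 (0 : F)) //= big1 => [|t _]; last first.
    by rewrite inE expr0n mulr0 !add0r oner_eq0.
  rewrite add0n /q -(cardC1 (0 : F)) -sum1_card; apply: eq_bigr => r r0.
  rewrite (bigD1 ((r ^+ 2 + 1) / r)) //= big1 => [|t tr]; rewrite inE.
    by rewrite mulfVK // addrAC addFF eqxx.
  rewrite -[t](mulfK r0) (inj_eq (mulIf (invr_neq0 r0))) in tr.
  by rewrite addrAC addr_eq0 oppF eq_sym (negPf tr).
suff : (card_traces 1 + card_traces 2 * 2 = q.-1)%N.
  by rewrite card_roots1 muln2 => <-.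
rewrite -sum_roots /card_traces !card_sum_mem big_distrl -big_split /=.
by apply: eq_bigr => t _; rewrite !inE; case/or3P: (card_roots_le t) => /eqP->.
Qed.

Lemma sl2_nonscalar a b c d : a * d - b * c = 1 -> sl2 a b c d != 1%g ->
  [|| b != 0, c != 0 | a != d].
Proof.
move=> D n1; apply: contraNT n1; rewrite !negb_or !negbK => /and3P[/eqP b0 /eqP c0 /eqP ad].
have a1 : a = 1 by apply: sqr_inj; rewrite expr1n -D b0 ad mul0r subr0.
by rewrite -sl2_1 b0 c0 -ad a1.
Qed.

Lemma card_cent_trace u : u \in SL 2 F -> u != 1%g ->
  #|'C_(SL 2 F)[u]%g| = (q.+1 - #|roots (\tr (GLval u))|)%N.
Proof.
case/SL2P=> a b c d D n1; rewrite (card_cent_sl2 D (sl2_nonscalar D n1)).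
by rewrite sl2E // tr_mx2 -(card_norm1_pairs (a + d)) addnK.
Qed.

(** The centralizer order determines the number [k] of roots, and each trace with [k] roots has q (q
    - 1 + k) elements. The identity has trace 0, which has one root, whence the correction at
    [k = 1]. *)
Lemma card_cent_class (k : nat) : (k <= 2)%N ->
  #|[set u in SL 2 F | (u != 1%g) && (#|'C_(SL 2 F)[u]%g| == q.+1 - k)%N]|
    = (card_traces k * (q * (q.-1 + k)) - (k == 1))%N.
Proof.
move=> k2; have rk t : (q.+1 - #|roots t| == q.+1 - k)%N = (#|roots t| == k).
  have : (#|roots t| <= 2)%N by case/or3P: (card_roots_le t) => /eqP->.
  by move=> r2; apply/eqP/eqP => [|->//]; move: q_gt1; lia.
transitivity #|[set u in SL 2 F | #|roots (\tr (GLval u))| == k] :\ 1%g|.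
  apply: eq_card => u; rewrite !inE; have [->|n1] /= := eqVneq u 1%g; first by rewrite andbF.
  case: (boolP (u \in SL 2 F)) => [Su|]; last by rewrite inE => /negPf->.
  by rewrite card_cent_trace // rk.
have := cardsD1 1%g [set u in SL 2 F | #|roots (\tr (GLval u))| == k].
rewrite [1%g \in _]inE group1 /= mxtrace_scalar mulr2n addFF roots0 eq_sym => cA.
have <- : #|[set u in SL 2 F | #|roots (\tr (GLval u))| == k]|
    = (card_traces k * (q * (q.-1 + k)))%N.
  rewrite -sum1_card (partition_big (fun u => \tr (GLval u)) (fun t => #|roots t| == k)) /=.
    rewrite -sum_nat_const; apply: eq_big => [t|t /eqP <-]; first by rewrite inE.
    rewrite -card_trace sum1dep_card; apply: eq_card => u; rewrite !inE.
    by have [->|] := eqVneq (\tr (GLval u)) t; rewrite ?eqxx ?andbT ?andbF.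
  by move=> u; rewrite inE => /andP[].
by rewrite cA addKn.
Qed.

Local Open Scope nat_scope.

Theorem kappa_SL2 :
  kappa (SL_group 2 F) =
    (q ^ ((q - 2) * (q + 1)) * (q - 1) ^ (((q - 3) * q * (q + 1)) %/ 2)
      * (q + 1) ^ (((q - 1) ^ 2 * q) %/ 2))%N.
Proof.
have q4 : (4 <= q)%N by rewrite /q cardF; apply: (@leq_pexp2l 2 2 n).
rewrite (@kappa_centralizers _ _ [:: q; q.-1; q.+1]); first last.
- move=> u Su n1; rewrite card_cent_trace //; rewrite !inE.
  by case/or3P: (card_roots_le (\tr (GLval u))) => /eqP->; lia.
- by rewrite /= !inE; lia.
- by move=> u /SL2P[a b c d D n1]; apply: abelian_cent_sl2 => //; apply: sl2_nonscalar.
rewrite !big_cons big_nil muln1.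
have c0 := @card_cent_class 0 isT; have c1 := @card_cent_class 1 isT.
have c2 := @card_cent_class 2 isT.
rewrite subn0 /= subn0 addn0 in c0; rewrite subn1 /= card_roots1 mul1n in c1.
rewrite subn2 subn0 /= in c2.
have n0 := card_traces_sum; have n2 := card_traces2.
rewrite {}c0 {}c1 {}c2 !subn1; move: q4 n0 n2.
move: (card_traces 0) (card_traces 2) q => k m r r4 n0 n2.
(* Here [r] is q, [m] is (q - 2)/2 and [k] is q/2. Since q is at least 4, [m] is positive and the
   divisor q - 2 is nonzero. *)
have kE : k = m.+1 by lia.
have rE : r = (m * 2).+2 by lia.
have m_gt0 : 0 < m by lia.
have e1 : (r * (r.-1 + 1)).-1 %/ r.-1 = r + 1.
  by rewrite -[RHS](@mulnK _ r.-1) rE //=; congr (_ %/ _); lia.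
have e2 : (r.-1 - 2) * ((m * (r * (r.-1 + 2))) %/ r.-1.-1) = ((r - 3) * r * (r + 1)) %/ 2.
  transitivity ((r - 3) * (m.+1 * (r + 1))).
    have -> : r.-1 - 2 = r - 3 by lia.
    congr (_ * _); rewrite -[RHS](@mulnK _ r.-1.-1) rE /= ?muln_gt0 ?m_gt0 //.
    by congr (_ %/ _); lia.
  by rewrite -[LHS](@mulnK _ 2) //; congr (_ %/ _); rewrite rE; lia.
have e3 : (r.+1 - 2) * ((k * (r * r.-1)) %/ r) = (r.-1 ^ 2 * r) %/ 2.
  have -> : (k * (r * r.-1)) %/ r = k * r.-1.
    by rewrite -[RHS](@mulnK _ r) ?rE //; congr (_ %/ _); lia.
  by rewrite -[LHS](@mulnK _ 2) //; congr (_ %/ _); rewrite kE rE; lia.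
by rewrite /= e1 e2 e3 mulnA addn1.
Qed.

End CharacteristicTwo.

(** * Isomorphisms with the alternating group of degree 5 *)

Section Alt5.
Local Open Scope group_scope.

(** Such a subgroup has index 2, hence is normal and meets the simple group A_5 in 1 or in A_5; the
    first would give 3600 products in a group of order 120. *)
Lemma Alt5_unique (H : {group {perm 'I_5}}) : #|H| = 60 -> H :=: 'Alt_('I_5).
Proof.
move=> cH; have c5 : #|'I_5| = 5 by rewrite card_ord.
have cS : #|'Sym_('I_5)| = 120 by rewrite card_Sym c5.
have cA : #|'Alt_('I_5)| = 60.
  by apply/eqP; rewrite -(eqn_pmul2l (isT : (0 < 2)%N)) card_Alt c5.
have nH : H <| 'Sym_('I_5).
  apply: index2_normal; first exact: subsetT.
  by rewrite -divgS ?subsetT // cS cH.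
have nHA : (H :&: 'Alt_('I_5)) <| 'Alt_('I_5).
  rewrite /normal subsetIr normsI ?normG //.
  by apply: subset_trans (normal_norm nH); apply: subsetT.
have sAH : 'Alt_('I_5) \subset H.
  case/simpleP: (simple_Alt5 (T := 'I_5) (eq_leq (esym c5))) => _ /(_ _ nHA)[HA1|<-].
    have := mul_cardG H 'Alt_('I_5); rewrite cH cA HA1 cards1 muln1.
    have : #|H * 'Alt_('I_5)| <= 120 by rewrite -cS subset_leq_card ?subsetT.
    by move=> le1 eq1; rewrite -eq1 in le1.
  exact: subsetIl.
by apply/esym/eqP; rewrite eqEcard sAH cA cH.
Qed.

(** An action of [G] on five points with kernel [Z] has an image of order 60 in S_5, which can only
    be A_5. *)
Lemma quotient_isog_Alt5 (gT : finGroupType) (G Z : {group gT}) (T : finType)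
    (act : gT -> T -> T) :
    #|T| = 5 -> act 1 =1 id -> {in G &, forall u v, act (u * v) =1 act v \o act u} ->
    Z :=: [set u in G | [forall x, act u x == x]] -> #|G| = (60 * #|Z|)%N ->
  G / Z \isog 'Alt_('I_5).
Proof.
move=> cT act1 actM ZE cG.
have [e [e' eK e'K]] : exists e : T -> 'I_5, exists2 e', cancel e e' & cancel e' e.
  exists (cast_ord cT \o enum_rank); exists (enum_val \o cast_ord (esym cT)) => x /=.
    by rewrite cast_ordK enum_rankK.
  by rewrite enum_valK cast_ordKV.
(* [is_action] asks for injectivity at every group element, so elements outside [G] act as the
   identity. *)
pose to y u := if u \in G then e (act u (e' y)) else y.
have toP : is_action G to.
  split=> [u y z|y u v Gu Gv]; rewrite /to; last by rewrite groupM // Gu Gv eK actM.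
  case: ifP => // Gu /(can_inj eK) eq_act; apply: (can_inj e'K).
  by rewrite -[LHS]act1 -[RHS]act1 -(mulgV u) !actM ?groupV //= eq_act.
pose aG := Action toP; pose f := actperm_morphism aG.
have fE u y : u \in G -> f u y = e (act u (e' y)).
  by move=> Gu; rewrite /= actpermE /= /to Gu.
have kf : 'ker f = Z.
  apply/setP => u; rewrite ZE [RHS]inE; case: (boolP (u \in G)) => [Gu|nGu]; last first.
    by apply/negbTE; apply: contra nGu; apply/subsetP/normal_sub/ker_normal.
  apply/(kerP _ Gu)/forallP => [fu x|fu].
    by have /permP/(_ (e x)) := fu; rewrite fE // perm1 eK => /(can_inj eK)->.
  by apply/permP => y; rewrite fE // (eqP (fu _)) e'K perm1.
have sZG : Z \subset G by rewrite ZE; apply/subsetP => u; rewrite inE => /andP[].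
have cf : #|f @* G| = 60%N.
  by rewrite card_morphim setIid kf -divgS // cG mulnK ?cardG_gt0.
have := first_isog f; rewrite (Alt5_unique cf); apply: isog_trans.
have -> : Z = ('ker f)%G by apply: group_inj.
exact: isog_refl.
Qed.

End Alt5.

(** * Centre, order and projective action of SL(2,F) *)

Section SL2Structure.
Variable F : finFieldType.
Local Open Scope ring_scope.
Import GRing.Theory.
Implicit Types (a b c d : F).
Let q := #|F|.

(** The abelian centralizer of a non-scalar central element would contain both elementary unipotent
    matrices, which do not commute. *)
Lemma center_SL2 : 'Z(SL 2 F)%g = [set sl2 a 0 0 a | a in [set a : F | a * a == 1]].
Proof.
apply/setP => u; apply/centerP/imsetP => [[/SL2P[a b c d D] cu] | [a]]; last first.
  rewrite inE => /eqP a1 ->; have D : a * a - 0 * 0 = 1 by rewrite a1 mul0r subr0.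
  split=> [|_ /SL2P[x y z t D']]; first exact: SL2_sl2.
  by rewrite /commute !sl2_mul //; congr (sl2 _ _ _ _); ring.
have [nsc|] := boolP [|| b != 0, c != 0 | a != d]; last first.
  rewrite !negb_or !negbK => /and3P[/eqP b0 /eqP c0 /eqP ad].
  exists a; last by rewrite b0 c0 -ad.
  by rewrite inE -D b0 -ad mul0r subr0.
have U : 1 * 1 - 1 * 0 = 1 :> F by ring.
have L : 1 * 1 - 0 * 1 = 1 :> F by ring.
have cU : sl2 1 1 0 1 \in 'C_(SL 2 F)[sl2 a b c d]%g.
  by rewrite inE SL2_sl2 //; apply/cent1P/esym/cu; apply: SL2_sl2.
have cL : sl2 1 0 1 1 \in 'C_(SL 2 F)[sl2 a b c d]%g.
  by rewrite inE SL2_sl2 //; apply/cent1P/esym/cu; apply: SL2_sl2.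
have := centsP (abelian_cent_sl2 D nsc) _ cU _ cL; rewrite /commute !sl2_mul //.
case/sl2_inj; [ring | ring |] => /eqP.
by rewrite !mulr1 mulr0 addr0 -subr_eq0 addrK oner_eq0.
Qed.

Lemma card_center_SL2 : #|'Z(SL 2 F)%g| = #|[set a : F | a * a == 1]|.
Proof.
rewrite center_SL2 card_in_imset // => a b; rewrite !inE => /eqP a1 /eqP b1.
by case/sl2_inj; rewrite ?a1 ?b1 ?mul0r ?subr0.
Qed.

(** Products with the matrices diag(t, 1) fill GL(2,F) without repetition, so its order is divided
    by q - 1. *)
Lemma card_SL2 : #|SL 2 F| = (q * q.-1 * q.+1)%N.
Proof.
have q_gt1 : (1 < q)%N by exact: finNzRing_gt1.
have q1_gt0 : (0 < q.-1)%N by rewrite -subn1 subn_gt0.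
pose g (t : F) : {'GL_2[F]} := insubd (1%g : {'GL_2[F]}) (mx2 t 0 0 1).
have gE t : t != 0 -> GLval (g t) = mx2 t 0 0 1.
  by move=> t0; rewrite /g /insubd insubT //= unitmxE det_mx2 mulr1 mul0r subr0 unitfE.
pose h (p : {'GL_2[F]} * F) := (p.1 * g p.2)%g.
have detS u : u \in SL 2 F -> \det (GLval u) = 1 by rewrite inE => /eqP.
have detg t : t != 0 -> \det (GLval (g t)) = t.
  by move=> t0; rewrite gE // det_mx2 mulr1 mul0r subr0.
have h_inj : {in setX (SL 2 F) [set~ 0] &, injective h}.
  move=> [u s] [v t]; rewrite !in_setX !in_setC1 /= => /andP[/detS Su s0] /andP[/detS Sv t0].
  rewrite /h /= => E; have st : s = t.
    have := congr1 (fun w : {'GL_2[F]} => \det (GLval w)) E.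
    by rewrite !GL_MxE !det_mulmx Su Sv !mul1r !detg.
  by rewrite st in E *; rewrite (mulIg _ _ _ E).
have := card_GL_2 F; rewrite -/q => cGL.
apply/eqP; rewrite -(eqn_pmul2r q1_gt0); apply/eqP.
rewrite -{1}(cardsC1 (0 : F)) -cardsX -(card_in_imset h_inj).
transitivity #|'GL_2[F]|%g; last by rewrite cGL; lia.
apply: eq_card => u; rewrite [RHS]inE; apply/imsetP.
have nz : \det (GLval u) != 0 by apply: GL_det.
exists ((u * (g (\det (GLval u)))^-1)%g, \det (GLval u)); last by rewrite /h /= mulgKV.
rewrite in_setX in_setC1 /= nz andbT inE; apply/eqP/(mulIf nz).
set w := (u * _)%g; have uE : u = (w * g (\det (GLval u)))%g by rewrite mulgKV.
have detM (x y : {'GL_2[F]}) : \det (GLval (x * y)%g) = \det (GLval x) * \det (GLval y).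
  by rewrite GL_MxE det_mulmx.
by have := detM w (g (\det (GLval u))); rewrite -uE detg // mul1r.
Qed.

Local Notation one_pt := (option F).

(* SL(2,F) acts on the right on the lines of row vectors: Some x is the line  *)
(* through (x, 1) and None the line through (1, 0).                           *)
Definition line_point (v : F * F) : one_pt := if v.2 == 0 then None else Some (v.1 / v.2).
Definition line_vec (z : one_pt) : F * F := if z is Some x then (x, 1) else (1, 0).

Definition line_act (u : {'GL_2[F]}) (z : one_pt) : one_pt :=
  let A := GLval u in let v := line_vec z in
  line_point (v.1 * A 0 0 + v.2 * A 1 0, v.1 * A 0 1 + v.2 * A 1 1).

Lemma line_act_sl2 a b c d z : a * d - b * c = 1 ->
  line_act (sl2 a b c d) z =
    line_point ((line_vec z).1 * a + (line_vec z).2 * c,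
                (line_vec z).1 * b + (line_vec z).2 * d).
Proof. by move=> D; rewrite /line_act sl2E // !mxE. Qed.

Lemma line_pointK x y : (x, y) != 0 ->
  exists2 k, k != 0 & line_vec (line_point (x, y)) = (k * x, k * y).
Proof.
rewrite /line_point /=; have [->|y0] := eqVneq y 0 => xy.
  have x0 : x != 0 by apply: contraNneq xy => ->.
  by exists x^-1; rewrite ?invr_eq0 //= mulVf // mulr0.
by exists y^-1; rewrite ?invr_eq0 //= mulVf // mulrC.
Qed.

Lemma line_pointZ k x y : k != 0 -> line_point (k * x, k * y) = line_point (x, y).
Proof.
move=> k0; rewrite /line_point /= mulf_eq0 (negPf k0) /=; case: eqP => // /eqP y0.
by congr Some; field; rewrite y0.
Qed.

Lemma line_act1 : line_act 1%g =1 id.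
Proof.
move=> z; rewrite -sl2_1 line_act_sl2; last by ring.
case: z => [x|] /=; rewrite /line_point /= !(mulr0, mulr1, mul1r, add0r, addr0) ?eqxx //.
by rewrite oner_eq0 divr1.
Qed.

Lemma line_actM :
  {in SL 2 F &, forall u v, line_act (u * v)%g =1 line_act v \o line_act u}.
Proof.
move=> _ _ /SL2P[a b c d D] /SL2P[a' b' c' d' D'] z.
rewrite /= sl2_mul // line_act_sl2; last first.
  transitivity ((a * d - b * c) * (a' * d' - b' * c')); first by ring.
  by rewrite D D' mul1r.
rewrite [line_act (sl2 a _ _ _) z]line_act_sl2 // line_act_sl2 //.
have: line_vec z != 0 by case: z => [x|]; rewrite /= -pair_eqE /= ?oner_eq0 ?andbF.
move: (line_vec z) => -[x y] /= xy0.
(* Cramer's rule recovers [(x, y)] from its image, which is therefore nonzero. *)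
have w0 : (x * a + y * c, x * b + y * d) != 0.
  apply: contraNneq xy0 => -[w1 w2]; apply/eqP; congr (_, _).
    transitivity ((x * a + y * c) * d - (x * b + y * d) * c).
      by transitivity (x * (a * d - b * c)); [rewrite D mulr1 | ring].
    by rewrite w1 w2 !mul0r subr0.
  transitivity ((x * b + y * d) * a - (x * a + y * c) * b).
    by transitivity (y * (a * d - b * c)); [rewrite D mulr1 | ring].
  by rewrite w1 w2 !mul0r subr0.
have [k k0 ->] := line_pointK w0; rewrite /= -!mulrA -!mulrDr line_pointZ //.
by congr line_point; congr (_, _); ring.
Qed.

(** Fixing [None], [Some 0] and [Some 1] forces in turn [b = 0], [c = 0] and [a = d]. *)
Lemma center_SL2_line_act :
  'Z(SL 2 F)%g = [set u in SL 2 F | [forall z, line_act u z == z]].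
Proof.
rewrite center_SL2; apply/setP => u; rewrite [RHS]inE; apply/imsetP/andP.
  case=> a; rewrite inE => /eqP a1 ->; have D : a * a - 0 * 0 = 1 by rewrite a1 mul0r subr0.
  have a0 : a != 0 by apply: contra_eq_neq a1 => ->; rewrite mul0r eq_sym oner_eq0.
  split; first exact: SL2_sl2.
  apply/forallP => z; rewrite line_act_sl2 // !mulr0 addr0 add0r ![_ * a]mulrC line_pointZ //.
  by case: z => [x|]; rewrite /line_point /= ?oner_eq0 ?eqxx ?divr1.
case=> /SL2P[a b c d D] /forallP fu.
have b0 : b = 0.
  have := fu None; rewrite line_act_sl2 // /line_point /= !mul1r !mul0r !addr0.
  by have [] := eqVneq b 0.
rewrite b0 mul0r subr0 in D.
have d0 : d != 0 by apply: contra_eq_neq D => ->; rewrite mulr0 eq_sym oner_eq0.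
have D' : a * d - b * c = 1 by rewrite b0 mul0r subr0.
have c0 : c = 0.
  have := fu (Some 0); rewrite line_act_sl2 // /line_point /= !mul0r !mul1r !add0r (negPf d0).
  by case/eqP=> /eqP; rewrite mulf_eq0 invr_eq0 (negPf d0) orbF => /eqP.
have ad : a = d.
  have := fu (Some 1); rewrite line_act_sl2 // /line_point /= !mul1r b0 c0.
  rewrite add0r addr0 (negPf d0).
  by case/eqP=> /(canRL (divfK d0)); rewrite mul1r.
by exists a; rewrite ?b0 ?c0 ?inE -?ad // {2}ad D.
Qed.

(** The projective line has five points, SL(2,4) has order 60, and its centre is trivial. *)
Theorem PSL2_4_isog_Alt5 : q = 4 -> 'L_2(F) \isog 'Alt_('I_5).
Proof.
move=> q4.
apply: (quotient_isog_Alt5 _ line_act1 line_actM center_SL2_line_act).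
  by rewrite card_option -/q q4.
rewrite card_SL2 q4 card_center_SL2.
have char2 : 2 \in [pchar F] by apply: (@card_finPcharP _ 2 2).
rewrite [#|_|](_ : _ = 1%N) //; apply/eqP/cards1P; exists 1; apply/setP => a; rewrite !inE.
by rewrite -expr2 sqrf_eq1 (oppr_pchar2 char2) orbb.
Qed.

End SL2Structure.

(** * The exceptional action of SL(2,5) on five points *)

Section PSL2Five.
Variable F : finFieldType.
Hypothesis cardF : #|F| = 5.
Local Open Scope ring_scope.
Import GRing.Theory.
Implicit Types (a b c d t x y z : F) (u v : {'GL_2[F]}).

Let char5 : 5%:R = 0 :> F.
Proof. by apply: (pcharf0 (p := 5)); apply: (@card_finPcharP _ 5 1). Qed.

(** Reduces an equation in the field to a [ring] identity, [z] being an explicit quotient by 5. *)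
Let eq_mod5 x y z : x - y = 5%:R * z -> x = y.
Proof. by rewrite char5 mul0r => /eqP; rewrite subr_eq0 => /eqP. Qed.

Let nat_neq0 : [/\ 2 != 0 :> F, 3 != 0 :> F & 4 != 0 :> F].
Proof.
have n2 : 2 != 0 :> F.
  apply: contra_neq (oner_neq0 F) => E; transitivity (5%:R - 2 * 2 : F); first by ring.
  by rewrite char5 E mulr0 subr0.
have n4 : 4 != 0 :> F by rewrite (_ : 4 = 2 * 2) ?mulf_neq0 //; ring.
split=> //; apply: contra_neq n2 => E; transitivity (5%:R - 3 : F); first by ring.
by rewrite char5 E subr0.
Qed.

Let inv2 : 2^-1 = 3 :> F.
Proof.
case: nat_neq0 => n2 _ _; apply: (mulfI n2); rewrite mulfV //.
by apply: (@eq_mod5 _ _ (-1)); ring.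
Qed.

Let inv3 : 3^-1 = 2 :> F.
Proof. by rewrite -inv2 invrK. Qed.

Let inv4 : 4^-1 = 4 :> F.
Proof.
case: nat_neq0 => _ _ n4; apply: (mulfI n4); rewrite mulfV //.
by apply: (@eq_mod5 _ _ (- 3%:R)); ring.
Qed.

Let F5P z : [\/ z = 0, z = 1, z = 2 | z = 3] \/ z = 4.
Proof.
have : z * (z - 1) * (z - 2) * (z - 3) * (z - 4) == 0.
  (* By Fermat, z^5 - z vanishes; the product differs from it by an explicit multiple of 5. *)
  rewrite (_ : _ * _ = (z ^+ 5 - z)
      + 5%:R * (- 2 * z ^+ 4 + 7 * z ^+ 3 - 10 * z ^+ 2 + 5 * z)).
    by rewrite -cardF expf_card subrr cardF char5 mul0r addr0.
  by ring.
rewrite !mulf_eq0 !subr_eq0.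
case/orP=> [|/eqP->]; last by right.
by do 3?[case/orP]; move/eqP->; left; constructor.
Qed.

(* The exotic action of PSL(2,5) on 5 points, identified with F: the lower    *)
(* unitriangular matrices act by translations, diag(t, 1/t) by x |-> t^2 x and *)
(* the Weyl element (0 1; -1 0) by x |-> 2 / x with 2 / 0 = 0; the case b != 0 *)
(* is the Bruhat decomposition.                                               *)
Definition five_map a b c d x : F :=
  if b == 0 then a * a * x + a * c else a / b + 2 / (b * (b * x + d)).

Definition five_act u x : F :=
  let A := GLval u in five_map (A 0 0) (A 0 1) (A 1 0) (A 1 1) x.

Lemma five_act_sl2 a b c d x : a * d - b * c = 1 ->
  five_act (sl2 a b c d) x = five_map a b c d x.
Proof. by move=> D; rewrite /five_act sl2E // !mxE. Qed.

Lemma five_act1 : five_act 1%g =1 id.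
Proof.
move=> x; rewrite -sl2_1 five_act_sl2; last by ring.
by rewrite /five_map eqxx !mul1r addr0.
Qed.

Lemma five_act_lower t u x : u \in SL 2 F ->
  five_act (u * (sl2 1 0 t 1)%R)%g x = five_act u x + t.
Proof.
case/SL2P=> a b c d D; have D' : 1 * 1 - 0 * t = 1 by ring.
rewrite sl2_mul // [LHS]five_act_sl2; last by rewrite -[RHS]D; ring.
rewrite five_act_sl2 //.
rewrite /five_map !mulr0 !mulr1 add0r.
have [b0|b0] := eqVneq b 0.
  rewrite b0 mul0r subr0 in D; rewrite b0.
  by transitivity (a * a * x + a * c + a * d * t); [ring | rewrite D mul1r].
by have -> : (a + b * t) / b = a / b + t; [field | rewrite add0r addrAC].
Qed.

Lemma five_act_diag t u x : t != 0 -> u \in SL 2 F ->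
  five_act (u * (sl2 t 0 0 t^-1)%R)%g x = t * t * five_act u x.
Proof.
move=> t0 /SL2P[a b c d D]; have D' : t * t^-1 - 0 * 0 = 1 by rewrite mulfV // mul0r subr0.
rewrite sl2_mul // [LHS]five_act_sl2; last first.
  by transitivity ((a * d - b * c) * (t / t)); [ring | rewrite D mulfV // mulr1].
rewrite five_act_sl2 //.
rewrite /five_map !mulr0 !addr0 !add0r mulf_eq0 invr_eq0 (negPf t0) orbF.
have [b0|b0] := eqVneq b 0; first by ring.
rewrite [RHS]mulrDr; congr (_ + _); first by field; apply/andP.
have -> : b / t * (b / t * x + d / t) = (b * (b * x + d)) / (t * t) by field.
by rewrite invf_div mulrCA.
Qed.

Lemma five_act_weyl u x : u \in SL 2 F ->
  five_act (u * (sl2 0 1 (-1) 0)%R)%g x = 2 / five_act u x.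
Proof.
case/SL2P=> a b c d D; have D' : 0 * 0 - 1 * -1 = 1 :> F by ring.
rewrite sl2_mul // [LHS]five_act_sl2; last by rewrite -[RHS]D; ring.
rewrite five_act_sl2 //.
rewrite /five_map !mulr0 !mulr1 !add0r !addr0 !mulrN1.
have [b0|b0] := eqVneq b 0.
  have a0 : a != 0 by apply: contra_eq_neq D => ->; rewrite b0 !mul0r subr0 eq_sym oner_eq0.
  by rewrite (negPf a0) b0 oppr0 mul0r add0r mulrDr mulrA.
have [a0|a0] := eqVneq a 0.
  rewrite a0 !mul0r add0r !invf_div mulrCA mulfV; last by case: nat_neq0.
  by rewrite mulr1; ring.
(* The determinant condition expresses [a * x + c] through [y = b * x + d]; then [key] applies to
   [a * y]. *)
have -> : a * x + c = (a * (b * x + d) - 1) / b by rewrite -D; field.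
move: (b * x + d) => y.
(* Not an identity of rational functions: with nonzero denominators it holds only at 2 and 4. At 0,
   1 and 3 a denominator vanishes and the convention that 0 inverts to 0 gives the equality. *)
have key z : -1 + 2 / (z - 1) = 2 / (1 + 2 / z).
  have E1 : 1 + 2 * 3 ^-1 = 0 :> F by rewrite inv3; apply: (@eq_mod5 _ _ 1); ring.
  case: (F5P z) => [[]|] ->.
  - rewrite invr0 mulr0 addr0 divr1 sub0r invrN1; apply: (@eq_mod5 _ _ (-1)); ring.
  - rewrite subrr invr0 mulr0 addr0 divr1 (_ : 1 + 2 = 3) ?inv3; last by ring.
    by apply: (@eq_mod5 _ _ (-1)); ring.
  - rewrite mulfV; last by case: nat_neq0.
    rewrite (_ : 2 - 1 = 1) ?divr1; last by ring.
    by rewrite (_ : 1 + 1 = 2) ?mulfV //; [ring | case: nat_neq0].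
  - rewrite E1 invr0 mulr0 (_ : 3 - 1 = 2) ?mulfV; [ring | case: nat_neq0 => // | ring].
  - rewrite inv4 (_ : 4 - 1 = 3) ?inv3; last by ring.
    rewrite (_ : 1 + 2 * 4 = 4) ?inv4; last by apply: (@eq_mod5 _ _ 1); ring.
    by apply: (@eq_mod5 _ _ (-1)); ring.
transitivity (b / a * (-1 + 2 / (a * y - 1))).
  rewrite mulrDr mulrN1 mulNr; congr (_ + _).
  by rewrite !invfM invrK; ring.
rewrite key; have [->|y0] := eqVneq y 0.
  by rewrite !mulr0 invr0 !mulr0 !addr0 divr1; field; apply/andP.
have -> : 1 + 2 / (a * y) = (a + 2 / y) / a by field; apply/andP.
have -> : a / b + 2 / (b * y) = (a + 2 / y) / b by field; apply/andP.
have [->|w0] := eqVneq (a + 2 / y) 0; first by rewrite !mul0r invr0 !mulr0.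
rewrite !invf_div; move: (a + 2 / y) w0 => w w0.
by field; apply/andP.
Qed.

(** The right factors [v] compatible with every [u] are closed under products and include the lower
    unitriangular, diagonal and Weyl elements, which generate the group. *)
Lemma five_actM :
  {in SL 2 F &, forall u v, five_act (u * v)%g =1 five_act v \o five_act u}.
Proof.
pose good v := v \in SL 2 F /\
  {in SL 2 F, forall u, five_act (u * v)%g =1 five_act v \o five_act u}.
have goodM v w : good v -> good w -> good (v * w)%g.
  move=> [Sv gv] [Sw gw]; split=> [|u Su x]; first exact: groupM.
  by rewrite mulgA gw ?groupM //= gv // gw.
(* Taking [u = 1] identifies [g] with the action of [v]. *)
have good_gen v g : v \in SL 2 F ->
    {in SL 2 F, forall u x, five_act (u * v)%g x = g (five_act u x)} -> good v.
  move=> Sv gv; split=> // u Su x; rewrite gv //=.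
  by rewrite -[v in RHS]mul1g gv ?group1 // five_act1.
have goodL t : good (sl2 1 0 t 1).
  apply: (good_gen _ (fun x => x + t)) => [|u Su x]; last exact: five_act_lower.
  by apply: SL2_sl2; ring.
have goodD t : t != 0 -> good (sl2 t 0 0 t^-1).
  move=> t0; apply: (good_gen _ (fun x => t * t * x)) => [|u Su x]; last exact: five_act_diag.
  by apply: SL2_sl2; rewrite mulfV // mul0r subr0.
have goodW : good (sl2 0 1 (-1) 0).
  apply: (good_gen _ (fun x => 2 / x)) => [|u Su x]; last exact: five_act_weyl.
  by apply: SL2_sl2; ring.
move=> u v Su Sv; suff [_] : good v by apply.
case/SL2P: Sv => a b c d D; have [b0|b0] := eqVneq b 0.
  rewrite b0 mul0r subr0 in D *.
  have a0 : a != 0 by apply: contra_eq_neq D => ->; rewrite mul0r eq_sym oner_eq0.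
  have dE : d = a^-1 by rewrite -[d](mulKf a0) D mulr1.
  suff -> : sl2 a 0 c d = ((sl2 a 0 0 a^-1)%R * (sl2 1 0 (a * c) 1)%R)%g by auto.
  rewrite sl2_mul; [|by rewrite mulfV // mul0r subr0|ring]; rewrite dE.
  by congr (sl2 _ _ _ _); [ring | ring | field | ring].
(* Bruhat decomposition for [b != 0]: lower unitriangular [d / b], Weyl element, diag(1/b, b), lower
   unitriangular [a / b]. *)
have b0' : b^-1 != 0 by rewrite invr_eq0.
have := goodM _ _ (goodM _ _ (goodM _ _ (goodL (d / b)) goodW) (goodD _ b0')) (goodL (a / b)).
rewrite invrK sl2_mul; [|ring|ring]; rewrite sl2_mul; [|ring|by field].
rewrite sl2_mul; [|by field|ring].
set g := sl2 _ _ _ _; suff -> : g = sl2 a b c d by [].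
have cE : c = (a * d - 1) / b by rewrite -D; field.
rewrite cE; congr (sl2 _ _ _ _); [field | ring | field | field] => //.
Qed.

Lemma center_SL2_five_act :
  'Z(SL 2 F)%g = [set u in SL 2 F | [forall x, five_act u x == x]].
Proof.
rewrite center_SL2; apply/setP => u; rewrite [RHS]inE; apply/imsetP/andP.
  case=> a; rewrite inE => /eqP a1 ->; have D : a * a - 0 * 0 = 1 by rewrite a1 mul0r subr0.
  split; first exact: SL2_sl2.
  apply/forallP => x; rewrite five_act_sl2 // /five_map eqxx a1 mulr0 addr0 mul1r.
  exact: eqxx.
case=> /SL2P[a b c d D] /forallP fu.
have {}fu x : five_map a b c d x = x by rewrite -five_act_sl2 //; apply/eqP.
have [b0|b0] := eqVneq b 0; last first.
  (* With [y] for [b * x + d]: [y = 0], where 2 / 0 = 0, gives [a = - d], and then [y = 1] gives 2 =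
     1. *)
  have fy y : a / b + 2 / (b * y) = (y - d) / b.
    have := fu ((y - d) / b); rewrite /five_map (negPf b0) => E; rewrite -[RHS]E.
    by have -> : b * ((y - d) / b) + d = y by field.
  have := fy 0; rewrite mulr0 invr0 mulr0 addr0 => /(divIf b0) aE.
  have := fy 1; rewrite aE sub0r => E.
  have : 2 = 1 :> F.
    have -> : 2 = b * (- d / b + 2 / (b * 1)) + d by field.
    by rewrite E; field.
  move/eqP; rewrite -subr_eq0 (_ : 2 - 1 = 1) ?oner_eq0 //; ring.
move: fu; rewrite /five_map b0 eqxx => fu; rewrite b0 mul0r subr0 in D.
have a0 : a != 0 by apply: contra_eq_neq D => ->; rewrite mul0r eq_sym oner_eq0.
have c0 : c = 0.
  have /eqP := fu 0; rewrite mulr0 add0r mulf_eq0 (negPf a0) => /eqP; exact.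
have a1 : a * a = 1 by have := fu 1; rewrite c0 mulr0 addr0 mulr1.
exists a; first by rewrite inE a1.
by rewrite c0; congr (sl2 _ _ _ _); apply: (mulfI a0); rewrite D a1.
Qed.

(** SL(2,5) has order 120, and the kernel of its action on five points is the centre, of order 2. *)
Theorem PSL2_5_isog_Alt5 : 'L_2(F) \isog 'Alt_('I_5).
Proof.
apply: (quotient_isog_Alt5 cardF five_act1 five_actM center_SL2_five_act).
rewrite card_SL2 cardF card_center_SL2.
have -> : [set a : F | a * a == 1] = [set 1; -1].
  by apply/setP => a; rewrite !inE -expr2 sqrf_eq1.
rewrite cards2 (_ : 1 != -1) // -subr_eq0 opprK; by case: nat_neq0.
Qed.

End PSL2Five.

(** * From SL(2,q) to L_2(q) for even q, and the case q = 4 *)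

Lemma SL2_isog_PSL2 (F : finFieldType) (n : nat) :
  #|F| = 2 ^ n -> (SL 2 F \isog 'L_2(F))%g.
Proof.
move=> cardF; have char2 := card_finPcharP cardF isT.
have isog_quo (gT : finGroupType) (G H : {group gT}) : H = 1%G -> (G \isog (G / H))%g.
  by move=> ->; apply: quotient1_isog.
apply: (isog_quo _ (SL_group 2 F) 'Z(SL 2 F)%G).
(* In characteristic 2 the only square root of 1 is 1, so the centre is trivial. *)
apply/group_inj/eqP; rewrite trivg_card1 card_center_SL2; apply/eqP.
rewrite (_ : [set _ | _] = [set 1%R]) ?cards1 //; apply/setP => a; rewrite !inE.
by rewrite -GRing.expr2 GRing.sqrf_eq1 (GRing.oppr_pchar2 char2) orbb.
Qed.

Theorem theorem4p2 :
  (forall (n : nat) (F : finFieldType),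
     (2 <= n)%N -> #|F| = (2 ^ n)%N ->
     let q := (2 ^ n)%N in
     kappa 'L_2(F)%G =
       (q ^ ((q - 2) * (q + 1))
        * (q - 1) ^ (((q - 3) * q * (q + 1)) %/ 2)
        * (q + 1) ^ (((q - 1) ^ 2 * q) %/ 2))%N)
  /\
  (forall F4 F5 : finFieldType,
     #|F4| = 4 -> #|F5| = 5 ->
     [/\ 'L_2(F4)%g \isog 'L_2(F5)%g,
         'L_2(F5)%g \isog 'Alt_('I_5)%g,
         kappa 'L_2(F5)%G = kappa 'Alt_('I_5)%G
       & kappa 'Alt_('I_5)%G = (2 ^ 20 * 3 ^ 10 * 5 ^ 18)%N]).
Proof.
have kappaL2 (n : nat) (F : finFieldType) (n2 : 2 <= n) (cF : #|F| = 2 ^ n) :=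
  etrans (esym (kappa_isog (H := 'L_2(F)%G) (SL2_isog_PSL2 cF))) (kappa_SL2 n2 cF).
split=> [n F n2 cF q | F4 F5 c4 c5].
  by rewrite (kappaL2 n F n2 cF) cF.
have iso4 := PSL2_4_isog_Alt5 c4; have iso5 := PSL2_5_isog_Alt5 c5.
have kappaA : kappa 'Alt_('I_5)%G = 2 ^ 20 * 3 ^ 10 * 5 ^ 18.
  rewrite -(kappa_isog (G := 'L_2(F4)%G) iso4) (kappaL2 2 F4 isT c4) c4.
  have -> : 4 - 1 = 3 by [].
  have -> : 4 + 1 = 5 by [].
  have -> : ((4 - 3) * 4 * 5) %/ 2 = 10 by [].
  have -> : (3 ^ 2 * 4) %/ 2 = 18 by [].
  have -> : (4 - 2) * 5 = 10 by [].
  have -> : 20 = 2 * 10 by [].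
  by rewrite expnM; have -> : 2 ^ 2 = 4 by [].
split=> //; first exact: isog_trans iso4 (isog_symr iso5).
exact: (kappa_isog (G := 'L_2(F5)%G) iso5).
Qed.
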